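(* Let $d\ge2$ be a fixed integer and let $(G_n)$ be a sequence of finite abelian groups of odd orders $N_n\to\infty$, with $M_n=(N_n-1)/2$. Let $$R_n^*=\inf\{r:\operatorname{diam}\Gamma_{G_n}^*(r)\le d\}.$$ If $G_{\mathrm{Gum}}$ is a random variable with distribution function $\mathbb P(G_{\mathrm{Gum}}\le c)=\exp\{-e^{-c}\}$ for $c\in\mathbb R$, then $$\frac{N_n^{d-1}}{d!}(R_n^* )^d-\log M_n\xrightarrow{d}G_{\mathrm{Gum}}.$$
   Context: For a finite abelian group $G$ (written additively) of odd order $N$, let $\mathcal Q_G=(G\setminus\{0\})/\{\pm1\}$ be the set of inversion classes $[a]=\{a,-a\}$. Let $(T_\xi)_{\xi\in\mathcal Q_G}$ be independent random variables uniform on $[0,1]$. The class $\xi$ is active at time $r$ if $T_\xi\le r$, and $\Gamma_G^*(r)$ is the undirected Cayley graph on $G$ whose connection set is the union of all classes active at time $r$; the graphs for different $r$ are thus coupled monotonically through the same variables $T_\xi$. The diameter is the graph diameter (infinite if the graph is disconnected). The symbol $\xrightarrow{d}$ denotes convergence in distribution. *)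

(* Defs.v *)
From HB Require Import structures.
From mathcomp Require Import all_boot all_order all_algebra.
From mathcomp Require Import all_classical all_reals all_analysis.
From mathcomp Require Import measurable_realfun.

Set Implicit Arguments.
Unset Strict Implicit.
Unset Printing Implicit Defensive.

Import Order.TTheory GRing.Theory Num.Theory.
Import numFieldNormedType.Exports.

Local Open Scope classical_set_scope.
Local Open Scope ring_scope.

Section Graph.
Context (R : realType) (V : finType).
Implicit Type e : rel V.

(* The infimum over the lengths of all walks from x to y, hence +oo when y is
   not reachable from x. *)
Definition graph_dist e (x y : V) : \bar R :=
  ereal_inf [set (size p)%:R%:E | p in [set p : seq V | path e x p /\ last x p = y]].

Definition diameter e : \bar R :=
  ereal_sup [set graph_dist e z.1 z.2 | z in [set: V * V]].

Lemma diameter_sub e e' : subrel e e' -> (diameter e' <= diameter e)%E.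
Proof.
move=> ee'; apply: ge_ereal_sup => _ [z _ <-].
apply: (@le_trans _ _ (graph_dist e z.1 z.2)); last first.
  by apply: ereal_sup_ubound; exists z.
apply: ereal_inf_le_tmp => _ [p [pe pl] <-]; exists p => //; split => //.
exact: sub_path pe.
Qed.

End Graph.

Section Cayley.
Context (G : finZmodType).

Definition inversion_classes : {set {set G}} :=
  [set [set a; - a]%SET | a in [set~ 0]%SET]%SET.

Definition inversion_class : finType :=
  {xi : {set G} | xi \in inversion_classes}.

Definition cayley_graph (S : {set G}) : rel G := fun x y => y - x \in S.

Definition connection_set (A : {set inversion_class}) : {set G} :=
  (\bigcup_(xi in A) val xi)%SET.

Lemma cayley_graph_sub (A B : {set inversion_class}) : A \subset B ->
  subrel (cayley_graph (connection_set A)) (cayley_graph (connection_set B)).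
Proof.
move=> AB x y; rewrite /cayley_graph /connection_set => /bigcupP[xi xiA yx].
by apply/bigcupP; exists xi => //; exact: (fintype.subsetP AB).
Qed.

End Cayley.

Section Process.
Context (R : realType) (G : finZmodType).

Definition active (t : inversion_class G -> R) (r : R)
  : {set inversion_class G} := [set xi | t xi <= r]%SET.

Definition Gamma (t : inversion_class G -> R) (r : R) : rel G :=
  cayley_graph (connection_set (active t r)).

(* Times r are nonnegative, which makes the set below bounded from below even
   for the trivial group; it is nonempty for d >= 1, all classes being active
   at large times. *)
Definition diam_time (d : nat) (t : inversion_class G -> R) : R :=
  inf [set r : R | 0 <= r /\ (diameter R (Gamma t r) <= d%:R%:E)%E].

End Process.

Section Probability.
Context (R : realType).

Definition mutually_independent (dO : measure_display) (Omega : measurableType dO)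
    (P : probability Omega R) (I : finType) (X : I -> {RV P >-> R}) : Prop :=
  forall (J : {set I}) (A : I -> set R), (forall i, measurable (A i)) ->
    P (\bigcap_(i in [set` J]) (X i @^-1` A i)) =
    (\prod_(i in J) P (X i @^-1` A i))%E.

Definition uniform01 (dO : measure_display) (Omega : measurableType dO)
    (P : probability Omega R) (X : {RV P >-> R}) : Prop :=
  forall A : set R, measurable A -> distribution P X A = uniform_prob (@ltr01 R) A.

Definition cvg_in_distribution (dO : nat -> measure_display)
    (Omega : forall n, measurableType (dO n))
    (P : forall n, probability (Omega n) R) (X : forall n, {RV (P n) >-> R})
    (dY : measure_display) (OmegaY : measurableType dY)
    (PY : probability OmegaY R) (Y : {RV PY >-> R}) : Prop :=
  forall c : R, {for c, continuous (cdf Y)} ->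
    cdf (X n) c @[n --> \oo] --> cdf Y c.

End Probability.

(* P is only a phantom parameter of {RV P >-> R}, so it cannot be inferred from
   an arbitrary measurable function. *)
Arguments mutually_independent {R dO Omega} P {I} X.
Arguments uniform01 {R dO Omega} P X.
Arguments cvg_in_distribution {R dO Omega} P X {dY OmegaY} PY Y.

Section Statistic.
Context (R : realType) (G : finZmodType) (dO : measure_display).
Context (Omega : measurableType dO) (P : probability Omega R).
Variables (d : nat) (T : inversion_class G -> {RV P >-> R}).

Definition diam_time_of (w : Omega) : R := diam_time d (fun xi => T xi w).

Let good (A : {set inversion_class G}) :=
  (diameter R (cayley_graph (connection_set A)) <= d%:R%:E)%E.

Let good_sub (A B : {set inversion_class G}) : A \subset B -> good A -> good B.
Proof.
by move=> AB; apply: le_trans; apply: diameter_sub; exact: cayley_graph_sub.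
Qed.

Let measurable_good (r : R) :
  measurable [set w | good (active (fun xi => T xi w) r)].
Proof.
rewrite (_ : [set _ | _] = \bigcup_(A in [set A | good A])
    \bigcap_(xi in [set` A]) (T xi @^-1` `]-oo, r])).
  apply: fin_bigcup_measurable => // A _.
  apply: fin_bigcap_measurable => // xi _.
  exact: measurable_funPTI.
apply/seteqP; split => w /=.
  move=> gw; exists (active (fun xi => T xi w) r); first exact: gw.
  by move=> xi /=; rewrite inE in_itv.
move=> [A /= gA wA]; apply: good_sub gA.
by apply/fintype.subsetP => xi xiA; rewrite inE; have := wA xi xiA; rewrite /= in_itv.
Qed.

Lemma measurable_diam_time : measurable_fun setT diam_time_of.
Proof.
have [gT|ngT] := boolP (good [set: inversion_class G]%SET); last first.
  rewrite (_ : diam_time_of = cst 0)//; apply/funext => w.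
  rewrite /diam_time_of /diam_time (_ : [set _ | _] = set0) ?inf0//.
  apply/seteqP; split => // r [_ gr]; move/negP: ngT; apply.
  by apply: good_sub gr; exact: finset.subsetT.
have actS w r r' : r <= r' ->
    active (fun xi => T xi w) r \subset active (fun xi => T xi w) r'.
  by move=> rr'; apply/fintype.subsetP => xi; rewrite !inE => /le_trans; exact.
apply: (measurability _ (RGenInftyO.measurableE R)) => //.
move=> _ [_ [y ->] <-]; rewrite setTI.
suff -> : diam_time_of @^-1` `]-oo, y[ =
    \bigcup_(q in [set q : rat | 0 <= (ratr q : R) < y])
      [set w | good (active (fun xi => T xi w) (ratr q))].
  rewrite bigcup_mkcond; apply: bigcupT_measurable_rat => q.
  by case: ifP => // _; exact: measurable_good.
have lb w : has_lbound [set r : R | 0 <= r /\ good (active (fun xi => T xi w) r)].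
  by exists 0 => r [].
apply/seteqP; split => w /=; rewrite in_itv /=; last first.
  move=> [q /= /andP[q0 qy] gq]; apply: le_lt_trans qy.
  by apply: ge_inf (lb w) _ _.
move/inf_lt => -[|r [r0 gr] ry].
  exists (\big[Num.max/0]_xi T xi w); split; first exact: bigmax_ge_id.
  apply: good_sub gT; apply/fintype.subsetP => xi _.
  by rewrite inE; exact: le_bigmax.
have [q] := rat_in_itvoo ry; rewrite in_itv /= => /andP[rq qy].
exists q => /=; first by rewrite qy andbT (le_trans r0) // ltW.
by apply: good_sub gr; apply: actS; exact: ltW.
Qed.

HB.instance Definition _ :=
  isMeasurableFun.Build _ _ _ _ diam_time_of measurable_diam_time.

Definition normalized_diam_time (w : Omega) : R :=
  #|G|%:R ^+ d.-1 / d`!%:R * diam_time_of w ^+ d - ln ((#|G|%:R - 1) / 2).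

Lemma measurable_normalized_diam_time : measurable_fun setT normalized_diam_time.
Proof.
apply: measurable_funB => //; apply: measurable_funM => //.
apply: measurable_funX; exact: measurable_diam_time.
Qed.

HB.instance Definition _ := isMeasurableFun.Build _ _ _ _
  normalized_diam_time measurable_normalized_diam_time.

End Statistic.

(* Main.v *)
Require Import Defs.
From mathcomp Require Import all_boot all_order all_algebra.
From mathcomp Require Import all_classical all_reals all_analysis.
From mathcomp Require Import ring lra zify.
Import Order.TTheory GRing.Theory Num.Theory.
Import numFieldNormedType.Exports.
Set Implicit Arguments.
Unset Strict Implicit.
Unset Printing Implicit Defensive.
Local Open Scope ring_scope.

(** Let [G] have odd order [N] and [M] inversion classes, and put
    [lam = N ^ (d - 1) p ^ d / d!] for a time [p].  The diameter at time [p] is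
    at most [d] exactly when every element is [covered], that is, a sum of [d]
    terms that are 0 or belong to active classes.  The normalized threshold is
    at most [c] exactly when this happens at the time with [lam = log M + c], so
    the theorem says that at this time the probability of covering everything
    tends to [exp (- exp (- c))].

    The heuristic is that an element has about [N ^ (d - 1) / d!]
    representations as a sum of [d] elements from distinct classes.  Each is
    active with probability [p ^ d], so that [lam] of them are active on average
    and the element stays uncovered with probability about
    [exp (- lam) = exp (- c) / M].  If the classes were uncovered independently,
    everything would be covered with probability
    [(1 - exp (- c) / M) ^ M -> exp (- exp (- c))].

    Independence is replaced by monotonicity.  Being uncovered is a decreasing
    event in the random set of active classes, hence by Harris's inequality the
    probability that none of the events occurs is at least the product of the
    complementary probabilities ([Pr_none_ge]) and exceeds it by at most the sum
    of the pairwise covariances ([Pr_none_le]).  As a consequence the first two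
    moments of the number of uncovered classes suffice.

    - One or two given classes stay uncovered with probability at most
      [exp (- lam)] and [exp (- 2 lam)], up to a factor tending to 1
      ([Pr_all_uncovered_le]).  This is Janson's inequality; its correlation
      term counts pairs of representations that share [k] classes.  There are
      [O(N ^ (2 d - k - 2))] of them ([card_overlap_lt], [card_overlap_full]),
      and they contribute [O((N p) ^ (2 d - k) / N ^ 2)], which is at most
      [N ^ (- 1 / d)] up to logarithms since [(N p) ^ d = N d! lam].

    - The expected number of uncovered classes is at least [exp (- c)] up to a
      factor tending to 1 ([sum_Pr_uncovered_ge]).  Harris's inequality handles
      the generic representations.  Those with fewer than [d] classes may be
      abundant for particular elements, for instance multiples [3 a] when [G]
      has 3-torsion, but they cover few elements altogether: only the sum over
      all elements is estimated, and [(N p) ^ (d - 1) / N] tends to 0.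

    The limit is taken in [cvg_Pr_all_covered].  The passage to the random times
    uses that the active set at a fixed time is a Bernoulli random set
    ([active_prob_pred]) and that the threshold is attained ([diam_time_leP]). *)

(** * Means over a random subset *)

Section BernoulliSubset.
Context {R : realType} {I : finType} (p : R).
Hypotheses (p0 : 0 <= p) (p1 : p <= 1).
Implicit Types (f g : {set I} -> R) (s : seq I) (A B C : {set I}).

(** The mean over independent coins attached to the entries of [s], tossed one
    after the other; this recursive form is what correlation inequalities are
    proved on. *)
Fixpoint coin_mean s f : R :=
  if s is i :: s' then
    p * coin_mean s' (fun A => f (i |: A)) + (1 - p) * coin_mean s' f
  else f finset.set0.

(** Expectation over the random subset of [I] that contains each point
    independently with probability [p]. *)
Definition bern_mean f : R :=
  \sum_(A : {set I}) p ^+ #|A| * (1 - p) ^+ #|~: A| * f A.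

(** The two terms of the recursion are the subsets of [i :: s] with and without
    [i]. *)
Lemma coin_meanE s f : uniq s ->
  coin_mean s f =
  \sum_(A : {set I} | A \subset [set x in s])
     p ^+ #|A| * (1 - p) ^+ (size s - #|A|) * f A.
Proof.
elim: s f => [|i s IHs] f /=.
  move=> _; rewrite (big_pred1 finset.set0) => [|A].
    by rewrite cards0 !expr0 !mul1r.
  have -> : [set x in [::]] = finset.set0 :> {set I} by apply/setP => x; rewrite !inE.
  by rewrite finset.subset0.
move=> /andP[is_ us].
have si : [set x in i :: s] = i |: [set x in s].
  by apply/setP => x; rewrite !inE.
have cs (A : {set I}) : A \subset [set x in s] -> (#|A| <= size s)%N.
  by move/subset_leq_card; rewrite cardsE (card_uniqP us).
have niA (A : {set I}) : A \subset [set x in s] -> i \notin A.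
  by move=> As; apply: contra is_ => /(fintype.subsetP As); rewrite inE.
rewrite !IHs// !mulr_sumr [RHS](bigID (fun A : {set I} => i \in A)) /=; congr (_ + _).
  rewrite [RHS](reindex_onto (fun A => i |: A) (fun A => A :\ i)) /=; last first.
    by move=> A /andP[_ iA]; rewrite finset.setD1K.
  apply: eq_big => [A|A As].
    apply/idP/idP => [As|/andP[/andP[]]].
      by rewrite si finset.setUS// finset.setU11 /= finset.setU1K ?niA.
    rewrite si => AS _ /eqP Ai; apply/fintype.subsetP => x xA.
    have /(fintype.subsetP AS) : x \in i |: A by rewrite !inE xA orbT.
    rewrite in_setU1; case/orP => // /eqP xi; move: xA; rewrite -Ai xi.
    by rewrite !inE eqxx.
  rewrite cardsU1 niA//= add1n subSS exprS; ring.
apply: eq_big => [A|A As].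
  rewrite si; apply/idP/andP => [As|[AS iA]].
    by split; [exact: fintype.subset_trans As (finset.subsetUr _ _)|exact: niA].
  apply/fintype.subsetP => x xA; have := fintype.subsetP AS _ xA.
  by rewrite in_setU1; case/orP => // /eqP xi; move: iA; rewrite -xi xA.
rewrite subSn ?cs// exprS; ring.
Qed.

Lemma bern_meanE f : bern_mean f = coin_mean (enum I) f.
Proof.
rewrite coin_meanE ?enum_uniq//; apply: eq_big => [A|A _].
  by apply/esym/fintype.subsetP => x _; rewrite inE mem_enum.
by congr (_ * _ ^+ _ * _); rewrite cardsCs finset.setCK -cardE.
Qed.

Lemma bern_meanD f g : bern_mean (f \+ g) = bern_mean f + bern_mean g.
Proof. by rewrite -big_split; apply: eq_bigr => A _; rewrite mulrDr. Qed.

Lemma bern_meanN f : bern_mean (fun A => - f A) = - bern_mean f.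
Proof. by rewrite -sumrN; apply: eq_bigr => A _; rewrite mulrN. Qed.

Lemma bern_meanB f g : bern_mean (fun A => f A - g A) = bern_mean f - bern_mean g.
Proof. by rewrite -bern_meanN -bern_meanD. Qed.

Lemma bern_mean_sum (J : Type) (r : seq J) (P : pred J) (f : J -> {set I} -> R) :
  bern_mean (fun A => \sum_(j <- r | P j) f j A) =
  \sum_(j <- r | P j) bern_mean (f j).
Proof.
by rewrite exchange_big; apply: eq_bigr => A _; rewrite mulr_sumr.
Qed.

Lemma eq_bern_mean f g : f =1 g -> bern_mean f = bern_mean g.
Proof. by move=> fg; apply: eq_bigr => A _; rewrite fg. Qed.

Lemma le_bern_mean f g : (forall A, f A <= g A) -> bern_mean f <= bern_mean g.
Proof.
move=> fg; apply: ler_sum => A _; apply: ler_wpM2l => //.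
by rewrite mulr_ge0// exprn_ge0// subr_ge0.
Qed.

Lemma coin_mean_cst s a : coin_mean s (fun=> a) = a.
Proof. by elim: s => //= i s ->; ring. Qed.

Lemma bern_mean_cst a : bern_mean (fun=> a) = a.
Proof. by rewrite bern_meanE coin_mean_cst. Qed.

Lemma bern_mean_ge0 f : (forall A, 0 <= f A) -> 0 <= bern_mean f.
Proof. by move=> f0; rewrite -(bern_mean_cst 0); exact: le_bern_mean. Qed.

Lemma le_coin_mean s f g : (forall A, f A <= g A) -> coin_mean s f <= coin_mean s g.
Proof.
elim: s f g => /= [|i s IHs] f g fg; first exact: fg.
by rewrite lerD// ler_wpM2l ?subr_ge0// IHs.
Qed.

Definition nondecr f := forall A B, A \subset B -> f A <= f B.
Definition nonincr f := forall A B, A \subset B -> f B <= f A.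

Lemma nonincr_pred (P : pred {set I}) :
  (forall A B, A \subset B -> P B -> P A) -> nonincr (fun A => (P A)%:R).
Proof.
by move=> PBA A B AB; rewrite ler_nat; have [/(PBA _ _ AB) ->|] := boolP (P B).
Qed.

Lemma nondecr_pred (P : pred {set I}) :
  (forall A B, A \subset B -> P A -> P B) -> nondecr (fun A => (P A)%:R).
Proof.
by move=> PAB A B AB; rewrite ler_nat; have [/(PAB _ _ AB) ->|] := boolP (P A).
Qed.

(** Harris's inequality.  Conditioning on the coin of [i] reduces it to the sign of
    the remainder: the means of [f] and [g] both increase with that coin, and the
    product of their increments, times [p (1 - p)], is the covariance created
    by it. *)
Lemma coin_mean_harris s f g : nondecr f -> nondecr g ->
  coin_mean s f * coin_mean s g <= coin_mean s (fun A => f A * g A).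
Proof.
elim: s f g => //= i s IHs f g fi gi.
have up h : nondecr h -> nondecr (fun A => h (i |: A)).
  by move=> hi A B AB; apply: hi; exact: finset.setUS.
have le1 h : nondecr h -> coin_mean s h <= coin_mean s (fun A => h (i |: A)).
  by move=> hi; apply: le_coin_mean => A; apply: hi; exact: finset.subsetUr.
have H1 := IHs _ _ (up _ fi) (up _ gi).
have H0 := IHs _ _ fi gi.
have := le1 _ fi; have := le1 _ gi.
set f0 := coin_mean s f in H0 *; set g0 := coin_mean s g in H0 *.
set f1 := coin_mean s _ in H1 *.
set g1 := coin_mean s (fun A => g _) in H1 *.
move=> g01 f01.
apply: (@le_trans _ _ (p * (f1 * g1) + (1 - p) * (f0 * g0))); last first.
  by rewrite lerD// ler_wpM2l ?subr_ge0.
rewrite -subr_ge0 [X in 0 <= X](_ : _ = p * (1 - p) * ((f1 - f0) * (g1 - g0))).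
  by rewrite !mulr_ge0 ?subr_ge0.
ring.
Qed.

Lemma bern_mean_harris f g : nondecr f -> nondecr g ->
  bern_mean f * bern_mean g <= bern_mean (fun A => f A * g A).
Proof. by move=> fi gi; rewrite !bern_meanE coin_mean_harris. Qed.

Lemma bern_mean_harris_decr f g : nonincr f -> nonincr g ->
  bern_mean f * bern_mean g <= bern_mean (fun A => f A * g A).
Proof.
move=> fi gi; rewrite -[leLHS]mulrNN -!bern_meanN.
under [leRHS]eq_bern_mean do rewrite -mulrNN.
by apply: bern_mean_harris => A B AB; rewrite lerN2; [exact: fi|exact: gi].
Qed.

Lemma bern_mean_harris_mixed f g : nondecr f -> nonincr g ->
  bern_mean (fun A => f A * g A) <= bern_mean f * bern_mean g.
Proof.
move=> fi gi; rewrite -lerN2 -mulrN -!bern_meanN.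
under [leRHS]eq_bern_mean do rewrite -mulrN.
by apply: bern_mean_harris => // A B AB; rewrite lerN2; exact: gi.
Qed.

(** The hypothesis says that no coin influences both functions. *)
Lemma coin_mean_indep s f g :
  (forall i, (forall A, f (i |: A) = f A) \/ (forall A, g (i |: A) = g A)) ->
  coin_mean s (fun A => f A * g A) = coin_mean s f * coin_mean s g.
Proof.
elim: s f g => //= i s IHs f g fg.
have eqc h h' : h =1 h' -> coin_mean s h = coin_mean s h' by move=> /funext ->.
have [fi|gi] := fg i.
- rewrite (eqc _ (fun A => f A * g (i |: A))) => [|A]; last by rewrite fi.
  rewrite [coin_mean s (fun A => f _)](eqc _ f fi) !IHs//; first by ring.
  move=> k; have [fk|gk] := fg k; [by left|right => A].
  by rewrite finset.setUCA gk.
- rewrite (eqc _ (fun A => f (i |: A) * g A)) => [|A]; last by rewrite gi.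
  rewrite [coin_mean s (fun A => g _)](eqc _ g gi) !IHs//; first by ring.
  move=> k; have [fk|gk] := fg k; [left => A|by right].
  by rewrite finset.setUCA fk.
Qed.

Lemma bern_mean_indep f g :
  (forall i, (forall A, f (i |: A) = f A) \/ (forall A, g (i |: A) = g A)) ->
  bern_mean (fun A => f A * g A) = bern_mean f * bern_mean g.
Proof. by move=> fg; rewrite !bern_meanE coin_mean_indep. Qed.

Lemma coin_mean_mem s i : uniq s -> i \in s ->
  coin_mean s (fun A => (i \in A)%:R) = p.
Proof.
elim: s => // k s IHs /andP[ks us]; rewrite inE /= => /orP[/eqP ik|is_].
  rewrite -{k}ik in ks *.
  have -> : (fun A : {set I} => (i \in i |: A)%:R) = fun=> 1 :> R.
    by apply/funext => A; rewrite finset.setU11.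
  rewrite coin_mean_cst mulr1 -[RHS]addr0; congr (_ + _).
  rewrite coin_meanE// big1 ?mulr0// => A As.
  rewrite (_ : (i \in A) = false) ?mulr0//; apply/negP => /(fintype.subsetP As).
  by rewrite inE (negPf ks).
have -> : (fun A : {set I} => (i \in k |: A)%:R) = fun A => (i \in A)%:R :> R.
  apply/funext => A; rewrite !inE (_ : (i == k) = false)//.
  by apply: contraNF ks => /eqP <-.
rewrite IHs//; ring.
Qed.

Lemma bern_mean_superset C : bern_mean (fun A => (C \subset A)%:R) = p ^+ #|C|.
Proof.
have [n] := ubnP #|C|; elim: n => // n IHn in C *; rewrite ltnS => Cn.
have [->|[i iC]] := finset.set_0Vmem C.
  under eq_bern_mean do rewrite finset.sub0set.
  by rewrite bern_mean_cst cards0.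
have cC : #|C| = #|C :\ i|.+1 by rewrite (cardsD1 i C) iC.
have -> : bern_mean (fun A => (C \subset A)%:R) =
    bern_mean (fun A => (i \in A)%:R * (C :\ i \subset A)%:R).
  apply: eq_bern_mean => A; rewrite -natrM mulnb.
  by rewrite -[in LHS](finset.setD1K iC) finset.subUset finset.sub1set.
rewrite bern_mean_indep => [|k]; last first.
  have [->|ki] := eqVneq k i; [right|left] => A; congr (nat_of_bool _)%:R.
    by apply/fintype.subsetP/fintype.subsetP => H x xC; have := H x xC;
       move: xC; rewrite !inE => /andP[/negPf ->].
  by rewrite !inE eq_sym (negPf ki).
rewrite IHn -?cC// cC exprS; congr (_ * _).
by rewrite bern_meanE coin_mean_mem ?enum_uniq// mem_enum.
Qed.

End BernoulliSubset.

(** * Poisson approximation for decreasing events *)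

Section DecreasingEvents.
Context {R : realType} {I : finType} (p : R).
Hypotheses (p0 : 0 <= p) (p1 : p <= 1).
Context {J : eqType} (U : J -> pred {set I}).
Hypothesis U_decr : forall j (A B : {set I}), A \subset B -> U j B -> U j A.

Local Notation Pr X := (bern_mean p (fun A => (X A)%:R)).

Let q j : R := Pr (U j).

Definition none (s : seq J) : pred {set I} := fun A => all (fun j => ~~ U j A) s.

Lemma none_incr s (A B : {set I}) : A \subset B -> none s A -> none s B.
Proof.
move=> AB /allP nA; apply/allP => j js; apply: contra (nA j js); exact: U_decr.
Qed.

Lemma none_cons m s A : (none (m :: s) A)%:R = (1 - (U m A)%:R) * (none s A)%:R :> R.
Proof. by rewrite /none /=; case: (U m A); rewrite ?subrr ?mul0r ?subr0 ?mul1r. Qed.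

Lemma nonincr_event j : nonincr (fun A => (U j A)%:R : R).
Proof. by apply: nonincr_pred => A B; exact: U_decr. Qed.

Lemma Pr_event_itv j : 0 <= q j <= 1.
Proof.
apply/andP; split; first by apply: bern_mean_ge0.
rewrite -[leRHS](bern_mean_cst (I := I) p 1); apply: le_bern_mean => // A.
by case: (U j A).
Qed.

(** Harris's inequality applies to the complements, which are increasing events. *)
Lemma Pr_none_ge s : \prod_(j <- s) (1 - q j) <= Pr (none s).
Proof.
elim: s => [|m s IHs]; first by rewrite big_nil bern_mean_cst.
rewrite big_cons; under eq_bern_mean do rewrite none_cons.
apply: le_trans (bern_mean_harris p0 p1 _ _); last 2 first.
- by move=> A B AB; rewrite lerD2l lerN2; exact: nonincr_event.
- by apply: nondecr_pred => A B; exact: none_incr.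
rewrite bern_meanB bern_mean_cst; apply: ler_wpM2l => //.
by rewrite subr_ge0; case/andP: (Pr_event_itv m).
Qed.

Let cov i j : R := Pr [pred A | U i A && U j A] - q i * q j.

Lemma cov_ge0 i j : 0 <= cov i j.
Proof.
rewrite subr_ge0; under [leRHS]eq_bern_mean do rewrite /= -mulnb natrM.
by apply: bern_mean_harris_decr => //; exact: nonincr_event.
Qed.

(** The indicator of [none s] increases with the random set, but adding the number
    of events that occur reverses this: when the indicator jumps from 0 to 1, at
    least one event ceases to occur. *)
Lemma nonincr_none_count s :
  nonincr (fun A => (none s A)%:R + \sum_(j <- s) (U j A)%:R : R).
Proof.
move=> A B AB; have [nB|_] := boolP (none s B); last first.
  by rewrite add0r ler_wpDl// ler_sum// => j _; exact: nonincr_event.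
rewrite [X in _ + X <= _]big_seq big1 => [|j js]; last first.
  by rewrite (negPf (allP nB j js)).
rewrite addr0; have [_|] := boolP (none s A).
  by rewrite lerDl sumr_ge0.
rewrite /none -has_predC add0r => /hasP[j js /= /negPn Uj].
by rewrite (big_rem j js) /= Uj lerDl sumr_ge0.
Qed.

(** The failure of independence between [U m] and [none s] is measured by
    covariances only: this is Harris's inequality for [U m] and the function of
    [nonincr_none_count]. *)
Lemma Pr_event_none_ge m s :
  q m * Pr (none s) - \sum_(j <- s) cov m j <=
  bern_mean p (fun A => (U m A)%:R * (none s A)%:R).
Proof.
have := bern_mean_harris_decr p0 p1 (@nonincr_event m) (nonincr_none_count s).
rewrite bern_meanD bern_mean_sum [leLHS]mulrDr.
under [leRHS]eq_bern_mean do rewrite mulrDr mulr_sumr.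
rewrite bern_meanD bern_mean_sum [X in _ + X <= _]mulr_sumr sumrB.
rewrite (_ : \sum_(j <- s) bern_mean p (fun A => (U m A)%:R * (U j A)%:R) =
  \sum_(j <- s) Pr [pred A | U m A && U j A]).
  rewrite -/(q m) -/(q _) /=; move: (Pr (none s)) (bern_mean p _) => N X.
  by move: (\sum_(j <- s) _) (\sum_(j <- s) _) => x y; lra.
by apply: eq_bigr => j _; apply: eq_bern_mean => A /=; rewrite -mulnb natrM.
Qed.

(** The events are removed one at a time, at the price given by
    [Pr_event_none_ge].  All covariances are nonnegative, so the sum may run over
    all ordered pairs. *)
Lemma Pr_none_le s : uniq s ->
  Pr (none s) <= \prod_(j <- s) (1 - q j) +
                 \sum_(i <- s) \sum_(j <- s | j != i) cov i j.
Proof.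
elim: s => [|m s IHs]; first by rewrite !big_nil addr0 bern_mean_cst.
move=> /= /andP[ms us]; have {IHs us} IHs := IHs us.
under eq_bern_mean do rewrite none_cons mulrBl mul1r.
rewrite bern_meanB.
have := Pr_event_none_ge m s.
rewrite !big_cons eqxx /=.
have -> : \sum_(j <- s | j != m) cov m j = \sum_(j <- s) cov m j.
  rewrite [LHS]big_seq_cond [RHS]big_seq; apply: eq_bigl => j.
  by case: (boolP (j \in s)) => //= js; case: eqVneq js ms => // -> ->.
have : \sum_(i <- s) \sum_(j <- s | j != i) cov i j <=
    \sum_(i <- s) \sum_(j <- m :: s | j != i) cov i j.
  apply: ler_sum => i _; rewrite [leRHS]big_cons; case: ifP => // _.
  by rewrite lerDr cov_ge0.
have /andP[q0 q1] := Pr_event_itv m.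
have := IHs.
have : 0 <= \sum_(i <- s) \sum_(j <- s | j != i) cov i j.
  by apply: sumr_ge0 => i _; apply: sumr_ge0 => j _; exact: cov_ge0.
set T := \sum_(i <- s) \sum_(j <- s | j != i) cov i j.
set S := \sum_(i <- s) \sum_(j <- m :: s | j != i) cov i j.
move: (\sum_(j <- s) cov m j) (\prod_(j <- s) (1 - q j)) T S => V P T S.
move: (bern_mean p _) (Pr (none s)) (q m) q0 q1 => X N Q Q0 Q1 T0 NP TS X1.
have : (1 - Q) * N <= (1 - Q) * (P + T) by rewrite ler_wpM2l// subr_ge0.
have : 0 <= Q * T by rewrite mulr_ge0.
nra.
Qed.

End DecreasingEvents.

(** * The Janson inequality *)

Section Janson.
Context {R : realType} {I : finType} (p : R).
Hypotheses (p0 : 0 <= p) (p1 : p <= 1).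
Context {J : eqType} (C : J -> {set I}).

Local Notation Pr X := (bern_mean p (fun A => (X A)%:R)).

Definition avoid (s : seq J) : pred {set I} := fun A => all (fun j => ~~ (C j \subset A)) s.

Lemma avoid_decr s (A B : {set I}) : A \subset B -> avoid s B -> avoid s A.
Proof.
move=> AB /allP aB; apply/allP => j js; apply: contra (aB j js).
by move=> CA; exact: fintype.subset_trans CA AB.
Qed.

Lemma nonincr_avoid s : nonincr (fun A => (avoid s A)%:R : R).
Proof. by apply: nonincr_pred => A B; exact: avoid_decr. Qed.

Lemma nondecr_superset (B : {set I}) : nondecr (fun A => (B \subset A)%:R : R).
Proof.
by apply: nondecr_pred => A A' AA' BA; exact: fintype.subset_trans BA AA'.
Qed.

Definition meet i j := ~~ [disjoint C i & C j].

(** Up to a union bound over the [C j] that meet [C m], only the [C j] disjoint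
    from [C m] have to be avoided; this is independent of [C m \subset A], and
    Harris's inequality takes it out of the error terms. *)
Lemma janson_step m s :
  (p ^+ #|C m| - \sum_(j <- s | meet m j) p ^+ #|C m :|: C j|) * Pr (avoid s) <=
  bern_mean p (fun A => (C m \subset A)%:R * (avoid s A)%:R).
Proof.
set D := \sum_(j <- s | _) _.
have a0 (h : {set I} -> nat) : 0 <= Pr h by apply: bern_mean_ge0.
(* A negative factor makes the bound trivial; a nonnegative one allows [s] to be
   replaced by [s2], which is easier to avoid. *)
have [neg|pos] := leP (p ^+ #|C m| - D) 0.
  apply: (@le_trans _ _ 0); first by rewrite mulr_le0_ge0// a0.
  by apply: bern_mean_ge0 => // A; rewrite mulr_ge0.
pose s2 := [seq j <- s | ~~ meet m j].
apply: (@le_trans _ _ ((p ^+ #|C m| - D) * Pr (avoid s2))).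
  rewrite ler_wpM2l ?(ltW pos)//; apply: le_bern_mean => // A.
  rewrite ler_nat; have [/allP av|//] := boolP (avoid s A).
  by rewrite /avoid (introT allP)// => j; rewrite mem_filter => /andP[_ /av].
apply: (@le_trans _ _ (bern_mean p (fun A => (C m \subset A)%:R * (avoid s2 A)%:R -
   \sum_(j <- s | meet m j) (C m :|: C j \subset A)%:R * (avoid s2 A)%:R))).
  rewrite bern_meanB bern_mean_sum mulrBl bern_mean_indep => [|i].
    rewrite bern_mean_superset lerD2l lerN2 mulr_suml ler_sum// => j _.
    rewrite -bern_mean_superset; apply: bern_mean_harris_mixed => //.
      exact: nondecr_superset.
    exact: nonincr_avoid.
  have [im|im] := boolP (i \in C m); last first.
    left => A; congr (nat_of_bool _)%:R; apply/fintype.subsetP/fintype.subsetP => H x xC.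
      by have := H x xC; rewrite !inE; case/orP => // /eqP xi; rewrite -xi xC in im.
    by rewrite in_setU1 H ?orbT.
  right => A; congr (nat_of_bool _)%:R; apply: eq_in_all => j.
  rewrite mem_filter negbK => /andP[dj _]; congr (~~ _).
  have ij : i \notin C j by move/disjoint_setI0/setP/(_ i): dj; rewrite !inE im => /negbT.
  apply/fintype.subsetP/fintype.subsetP => H x xC.
    by have := H x xC; rewrite !inE; case/orP => // /eqP xi; rewrite -xi xC in ij.
  by rewrite in_setU1 H ?orbT.
apply: le_bern_mean => // A.
have [CA|CA] := boolP (C m \subset A); last first.
  rewrite !mul0r sub0r oppr_le0; apply: sumr_ge0 => j _; by rewrite mulr_ge0.
rewrite !mul1r; have [a2|a2] := boolP (avoid s2 A); last first.
  by rewrite big1 ?subr0// => j _; rewrite mulr0.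
have [_|] := boolP (avoid s A).
  by rewrite gerBl sumr_ge0// => j _; rewrite mulr_ge0.
rewrite /avoid -has_predC => /hasP[j js /= /negPn Cj].
have mj : meet m j.
  apply: contraTT Cj => mj; apply: (allP a2).
  by rewrite mem_filter mj.
rewrite subr_le0 (big_rem j js) /= mj finset.subUset CA Cj mul1r.
by rewrite lerDl sumr_ge0// => k _; rewrite mulr_ge0.
Qed.

(** The converse bound, again from Harris's inequality. *)
Lemma Pr_avoid_ge s : \prod_(j <- s) (1 - p ^+ #|C j|) <= Pr (avoid s).
Proof.
elim: s => [|m s IHs]; first by rewrite big_nil bern_mean_cst.
have -> : Pr (avoid (m :: s)) =
    bern_mean p (fun A => (1 - (C m \subset A)%:R) * (avoid s A)%:R).
  apply: eq_bern_mean => A; rewrite /avoid /=.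
  by case: (C m \subset A); rewrite ?subrr ?mul0r// subr0 mul1r.
rewrite big_cons; apply: le_trans (bern_mean_harris_decr p0 p1 _ _); last 2 first.
- by move=> A B AB; rewrite lerD2l lerN2; exact: nondecr_superset.
- exact: nonincr_avoid.
rewrite bern_meanB bern_mean_cst bern_mean_superset; apply: ler_wpM2l => //.
by rewrite subr_ge0 exprn_ile1.
Qed.

(** Each [C m] in turn multiplies the probability of avoidance by at most
    [1 - p ^ #|C m|] plus its correlation with the [C j] that follow, and
    [1 + x <= expR x]. *)
Lemma janson s : uniq s ->
  Pr (avoid s) <= expR (- (\sum_(j <- s) p ^+ #|C j|) +
    \sum_(i <- s) \sum_(j <- s | (j != i) && meet i j) p ^+ #|C i :|: C j|).
Proof.
elim: s => [|m s IHs]; first by rewrite !big_nil addr0 oppr0 expR0 bern_mean_cst.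
move=> /= /andP[ms us]; have {IHs us} IHs := IHs us.
have -> : Pr (avoid (m :: s)) = Pr (avoid s) -
    bern_mean p (fun A => (C m \subset A)%:R * (avoid s A)%:R).
  rewrite -bern_meanB; apply: eq_bern_mean => A.
  by rewrite /avoid /=; case: (C m \subset A); rewrite ?mul1r ?subrr// mul0r subr0.
have := janson_step m s.
set D := \sum_(j <- s | _) _; set P := Pr (avoid s); set X := bern_mean p _ => PX.
rewrite !big_cons eqxx /=.
have -> : \sum_(j <- s | (j != m) && meet m j) p ^+ #|C m :|: C j| = D.
  rewrite [LHS]big_seq_cond [RHS]big_seq_cond; apply: eq_bigl => j.
  by case: (boolP (j \in s)) => //= js; case: eqVneq js ms => // -> ->.
set S := \sum_(i <- s) \sum_(j <- m :: s | _) _.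
have DS : \sum_(i <- s) \sum_(j <- s | (j != i) && meet i j) p ^+ #|C i :|: C j| <= S.
  apply: ler_sum => i _; rewrite [leRHS]big_cons; case: ifP => // _.
  by rewrite lerDr exprn_ge0.
have P0 : 0 <= P by apply: bern_mean_ge0.
apply: (@le_trans _ _ (P * (1 + (D - p ^+ #|C m|)))).
  by rewrite mulrDr mulr1 lerD2l -opprB mulrN lerN2 mulrC.
apply: (@le_trans _ _ (P * expR (D - p ^+ #|C m|))).
  by rewrite ler_wpM2l// expR_ge1Dx.
apply: le_trans (ler_wpM2r (expR_ge0 _) IHs) _.
rewrite -expRD ler_expR; move: DS; lra.
Qed.

End Janson.

(** * Counting sets with prescribed sum *)

Section Counting.
Import mathcomp.boot.finset.

Lemma ffact_le_expn n m : (n ^_ m <= n ^ m)%N.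
Proof.
by elim: m => // m IHm; rewrite ffactnSr expnSr leq_mul// leq_subr.
Qed.

Lemma card_subsets_fact_le (T : finType) m :
  (m`! * #|[set A : {set T} | #|A| == m]| <= #|T| ^ m)%N.
Proof. by rewrite card_draws mulnC bin_ffact ffact_le_expn. Qed.

Lemma card_subsets_le_expn (T : finType) m :
  (#|[set A : {set T} | #|A| == m]| <= #|T| ^ m)%N.
Proof. by apply: leq_trans (card_subsets_fact_le _ _); rewrite leq_pmull ?fact_gt0. Qed.

Lemma card_pairs (S T : finType) (F : {set S}) (Q : S -> pred T) :
  #|[set x : S * T | (x.1 \in F) && Q x.1 x.2]| =
  (\sum_(A in F) #|[set b | Q A b]|)%N.
Proof.
rewrite -sum1_card; under [RHS]eq_bigr do rewrite -sum1_card.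
rewrite pair_big_dep /=; apply: eq_bigl => -[a b].
by rewrite !inE.
Qed.

Lemma card_inj_le (S T : finType) (A : {set S}) (B : {set T}) (f : S -> T) :
  {in A &, injective f} -> (forall x, x \in A -> f x \in B) -> (#|A| <= #|B|)%N.
Proof.
move=> fi fAB; rewrite -(card_in_imset fi); apply: subset_leq_card.
by apply/fintype.subsetP => _ /imsetP[x xA ->]; exact: fAB.
Qed.

End Counting.

Section AbelianGroup.
Import mathcomp.boot.finset.
Context {G : finZmodType}.
Implicit Types (A B U W : {set G}) (a b x y z : G).
Local Notation N := #|G|.

Lemma mulrn_cardG x : x *+ N = 0.
Proof.
have : \sum_y y = \sum_y (x + y) :> G.
  by rewrite (reindex_inj (addrI x)).
by rewrite big_split sumr_const /= => /esym /(canRL (addrK _)); rewrite subrr.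
Qed.

(** The elements of such a set are nonzero and lie in distinct inversion classes. *)
Definition antipode_free A := [forall a in A, - a \notin A].

Definition neg A := [set - a | a in A].

Lemma mem_neg A a : (a \in neg A) = (- a \in A).
Proof. by rewrite -[in LHS](opprK a) mem_imset//; exact: oppr_inj. Qed.

Lemma card_neg A : #|neg A| = #|A|.
Proof. by rewrite card_imset//; exact: oppr_inj. Qed.

Lemma antipode_freeP A : reflect (forall a, a \in A -> - a \notin A) (antipode_free A).
Proof. exact: forall_inP. Qed.

Lemma antipode_free_n0 A : antipode_free A -> 0 \notin A.
Proof. by move/antipode_freeP => H; apply/negP => /[dup] /H; rewrite oppr0 => /negP. Qed.

Definition generic m := [set A : {set G} | (#|A| == m) && antipode_free A].

(** The generic representations of [z]: sums of [m] elements taken from [m]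
    distinct classes. *)
Definition reps m z := [set A in generic m | \sum_(a in A) a == z].

Lemma genericP m A : reflect (#|A| = m /\ antipode_free A) (A \in generic m).
Proof. by rewrite inE; apply: (iffP andP) => -[/eqP ? ?]; split=> //; apply/eqP. Qed.

Lemma repsP m z A :
  reflect [/\ #|A| = m, antipode_free A & \sum_(a in A) a = z] (A \in reps m z).
Proof.
rewrite inE; apply: (iffP andP) => [[/genericP[? ?] /eqP ?]|[? ? ?]]; split=> //.
  exact/genericP.
exact/eqP.
Qed.

Lemma sumU1 a A : a \notin A -> \sum_(b in a |: A) b = a + \sum_(b in A) b.
Proof. by move=> aA; rewrite big_setU1. Qed.

Lemma sumD1 a A : a \in A -> \sum_(b in A :\ a) b = (\sum_(b in A) b) - a.
Proof. by move=> aA; rewrite [in RHS](big_setD1 a)//= addrAC subrr add0r. Qed.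

Lemma cardD1_mem m a A : #|A| = m.+1 -> a \in A -> #|A :\ a| = m.
Proof. by move=> + aA; rewrite (cardsD1 a) aA => -[]. Qed.

(** Deleting an element loses no information, as the sum gives it back. *)
Lemma card_sum_eq m z :
  (#|[set A : {set G} | (#|A| == m.+1) && (\sum_(a in A) a == z)%R]| <= N ^ m)%N.
Proof.
apply: leq_trans (card_subsets_le_expn _ _).
pose f A := (z - \sum_(a in A) a) |: A.
apply: (@leq_trans #|f @: [set A : {set G} | #|A| == m]|); last exact: leq_imset_card.
apply: subset_leq_card; apply/fintype.subsetP => A; rewrite inE => /andP[/eqP cA /eqP sA].
have /card_gt0P[a aA] : (0 < #|A|)%N by rewrite cA.
apply/imsetP; exists (A :\ a); first by rewrite inE (cardD1_mem cA).
by rewrite /f sumD1// sA opprB addrC subrK setD1K.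
Qed.

Lemma card_reps_le m z : (#|reps m.+1 z| <= N ^ m)%N.
Proof.
apply: leq_trans (card_sum_eq m z); apply: subset_leq_card; apply/fintype.subsetP => A.
by move=> /repsP[cA _ sA]; rewrite inE cA sA !eqxx.
Qed.

Lemma card_marked m (F : {set {set G}}) : (forall A, A \in F -> #|A| = m) ->
  #|[set x : {set G} * G | (x.1 \in F) && (x.2 \in x.1)]| = (m * #|F|)%N.
Proof.
move=> Fm; rewrite (@card_pairs _ _ F (fun A a => a \in A)) mulnC -sum_nat_const.
by apply: eq_bigr => A AF; rewrite (_ : [set b | b \in A] = A) ?Fm//; apply/setP => a; rewrite inE.
Qed.

Lemma generic_fact_le m : (m`! * #|generic m| <= N ^ m)%N.
Proof.
apply: leq_trans (card_subsets_fact_le _ _); rewrite leq_mul2l; apply/orP; right.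
apply: subset_leq_card; apply/fintype.subsetP => A.
by move=> /genericP[cA _]; rewrite inE cA.
Qed.

(** Deleting a marked element is injective on the representations of a given [z]. *)
Lemma reps_fact_le m z : (m.+1`! * #|reps m.+1 z| <= N ^ m)%N.
Proof.
apply: leq_trans (card_subsets_fact_le _ _).
rewrite factS -mulnA mulnCA leq_mul2l; apply/orP; right.
rewrite -(@card_marked _ (reps m.+1 z)); last by move=> A /repsP[].
apply: (@card_inj_le _ _ _ _ (fun x : {set G} * G => x.1 :\ x.2)).
  move=> [A a] [B b]; rewrite !inE /= => /andP[/andP[_ /eqP sA] aA].
  move=> /andP[/andP[_ /eqP sB] bB] AB.
  have ab : a = b.
    have := sumD1 aA; rewrite AB sumD1// sA sB.
    by move/addrI/oppr_inj.
  by rewrite -ab in bB AB *; rewrite -(setD1K aA) AB setD1K.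
move=> [A a]; rewrite inE /= => /andP[/repsP[cA _ _] aA].
by rewrite inE (cardD1_mem cA).
Qed.

(** For antipode-free [B], the number of classes that meet both [A] and [B], see
    [card_classes_ofI]. *)
Definition overlap A B := #|B :&: (A :|: neg A)|.

(** For a given [A], the set [B] consists of a part inside [A :|: neg A], with
    boundedly many possibilities, and of a nonempty rest with prescribed sum. *)
Lemma card_overlap_lt m k z z' : (k <= m)%N ->
  (#|[set x : {set G} * {set G} | (x.1 \in reps m.+1 z) &&
      ((x.2 \in reps m.+1 z') && (overlap x.1 x.2 == k))]| <=
   4 ^ m.+1 * N ^ (m + (m - k)))%N.
Proof.
move=> km; rewrite (@card_pairs _ _ _ (fun A B => (B \in reps m.+1 z') && (overlap A B == k))).
apply: (@leq_trans (\sum_(A in reps m.+1 z) 4 ^ m.+1 * N ^ (m - k))); last first.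
  by rewrite sum_nat_const expnD mulnCA leq_mul// leq_mul// card_reps_le.
apply: leq_sum => A /repsP[cA _ _].
pose T := A :|: neg A.
have cT : (#|T| <= 2 * m.+1)%N.
  by apply: leq_trans (leq_card_setU _ _) _; rewrite card_neg cA mul2n addnn.
pose X := [set x : {set G} * {set G} | (x.1 \in powerset T) &&
   ((#|x.2| == (m - k).+1) && (\sum_(a in x.2) a == z' - \sum_(a in x.1) a))].
apply: (@leq_trans #|X|).
  apply: (@card_inj_le _ _ _ _ (fun B => (B :&: T, B :\: T))).
    by move=> B C _ _ [h1 h2]; rewrite -(setID B T) h1 h2 setID.
  move=> B; rewrite inE => /andP[/repsP[cB _ sB] /eqP oB].
  rewrite inE /= inE subsetIr /=; apply/andP; split.
    rewrite -(eqn_add2l (overlap A B)) {1}/overlap cardsID cB oB; lia.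
  by rewrite -sB [X in X - _](big_setID T) /= addrAC subrr add0r.
rewrite (@card_pairs _ _ _ (fun U W => (#|W| == (m - k).+1) &&
  (\sum_(a in W) a == z' - \sum_(a in U) a))).
apply: (@leq_trans (\sum_(U in powerset T) N ^ (m - k))).
  by apply: leq_sum => U _; exact: card_sum_eq.
rewrite sum_nat_const leq_mul2r card_powerset; apply/orP; right.
by rewrite (_ : 4 = 2 ^ 2)%N// -expnM leq_exp2l.
Qed.

(** Full overlap means that [B] arises from [A] by changing some signs. *)
Lemma flip_decomposition m A B : A \in generic m -> B \in generic m -> overlap A B = m ->
  B = (A :&: B) :|: neg (A :\: B).
Proof.
move=> /genericP[cA _] /genericP[cB /antipode_freeP fB] oAB.
have BT : B \subset A :|: neg A.
  apply/setIidPl/eqP; rewrite eqEcard subsetIl -/(overlap A B) oAB cB leqnn//.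
apply/eqP; rewrite eqEcard; apply/andP; split; last first.
  apply: leq_trans (leq_card_setU _ _) _; rewrite card_neg cardsID cA cB//.
apply/fintype.subsetP => b bB; have := fintype.subsetP BT b bB.
rewrite !in_setU in_setI bB andbT => /orP[->//|]; rewrite !mem_neg in_setD => ->.
by rewrite fB ?orbT.
Qed.

Hypothesis Godd : odd #|G|.

(** The inverse of doubling, [N.+1./2] being the inverse of 2 modulo [N]. *)
Definition half x := x *+ N.+1./2.

Lemma halfK x : half x + half x = x.
Proof.
have -> : half x + half x = x *+ N.+1.
  by rewrite /half -mulrnDr addnn even_halfK//= Godd.
by rewrite mulrS mulrn_cardG addr0.
Qed.

Lemma half_uniq x h : h + h = x -> h = half x.
Proof.
move=> <-; rewrite /half mulrnDl -/(half h) halfK//.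
Qed.

Lemma opp_neq x : x != 0 -> - x != x.
Proof.
apply: contra_neq => xx; have : x + x = 0 by rewrite -[in X in X + _]xx addNr.
by move/half_uniq => ->; rewrite /half mul0rn.
Qed.

Lemma antipode_freeU1 a A : antipode_free A -> a \notin A -> - a \notin A ->
  a != 0 -> antipode_free (a |: A).
Proof.
move=> /antipode_freeP fA aA naA a0; apply/antipode_freeP => b.
rewrite !in_setU1 negb_or => /orP[/eqP ->|bA]; first by rewrite opp_neq.
rewrite fA// andbT; apply: contra naA => /eqP <-; by rewrite opprK.
Qed.

(** At most [2 m + 1] elements cannot be added to a given antipode-free set of size
    [m], and a set of size [m + 1] arises once for each of its elements. *)
Lemma card_generic_step m :
  (N * #|generic m| <= m.+1 * #|generic m.+1| + (2 * m).+1 * #|generic m|)%N.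
Proof.
pose ok A a := [&& a \notin A, - a \notin A & a != 0].
have : (#|[set x : {set G} * G | (x.1 \in generic m) && ok x.1 x.2]| <= m.+1 * #|generic m.+1|)%N.
  rewrite -(@card_marked _ (generic m.+1)); last by move=> A /genericP[].
  apply: (@card_inj_le _ _ _ _ (fun x : {set G} * G => (x.2 |: x.1, x.2))).
    move=> [A a] [B b]; rewrite !inE /= => /andP[_ /andP[aA _]] /andP[_ /andP[bB _]] [AB ab].
    by rewrite -ab in AB bB *; rewrite -(setU1K aA) AB setU1K.
  move=> [A a]; rewrite inE /= => /andP[/genericP[cA fA] /and3P[aA naA a0]].
  rewrite inE /= setU11 andbT; apply/genericP.
  by rewrite cardsU1 aA cA antipode_freeU1.
rewrite card_pairs => le1.
have le2 : (\sum_(A in generic m) #|[set a | ~~ ok A a]| <= (2 * m).+1 * #|generic m|)%N.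
  rewrite mulnC -sum_nat_const; apply: leq_sum => A /genericP[cA _].
  apply: (@leq_trans #|0 |: (A :|: neg A)|).
    apply: subset_leq_card; apply/fintype.subsetP => a.
    rewrite !inE mem_neg /ok !negb_and !negbK.
    by case/or3P => ->; rewrite ?orbT.
  rewrite cardsU1 -add1n leq_add ?leq_b1//.
  by apply: leq_trans (leq_card_setU _ _) _; rewrite card_neg cA mul2n addnn.
rewrite mulnC -sum_nat_const; apply: leq_trans (leq_add le1 le2).
rewrite -big_split /=; apply: leq_sum => A _.
rewrite -(cardsC [set a | ok A a]) leq_add2l; apply: subset_leq_card.
by apply/fintype.subsetP => a; rewrite !inE.
Qed.

(** Iterating [card_generic_step], where [(m + 1) ^ 2] is the sum of the odd
    numbers [2 k + 1] for [k <= m]. *)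
Lemma card_generic_ge m :
  (N ^ m.+1 <= m.+1`! * #|generic m.+1| + m.+1 ^ 2 * N ^ m)%N.
Proof.
have step k : (N * (k`! * #|generic k|) <= k.+1`! * #|generic k.+1| + (2 * k).+1 * N ^ k)%N.
  have := card_generic_step k; have := generic_fact_le k.
  rewrite factS; move: (#|generic k|) (#|generic k.+1|) (N ^ k)%N (k`!)%N => g g' P f le1 le2.
  have := leq_mul (leqnn f) le2; have := leq_mul (leqnn (2 * k).+1) le1.
  nia.
elim: m => [|m IHm].
  have := step 0%N; rewrite fact0 mul1n (_ : #|generic 0| = 1%N) ?muln1//.
  rewrite (_ : generic 0 = [set set0]) ?cards1//; apply/setP => A; rewrite !inE cards_eq0.
  by case: eqP => //= ->; apply/antipode_freeP => a; rewrite inE.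
have := step m.+1; have := leq_mul (leqnn N) IHm.
rewrite (expnS N m.+1) => h1 h2; move: h1 h2; rewrite (expnS N m).
move: (#|generic m.+1|) (#|generic m.+2|) (N ^ m)%N (m.+1`!)%N (m.+2`!)%N => g g' P f f'.
nia.
Qed.

(** An antipode-free set [A] of size [m + 1] is completed to a representation of [z]
    by [e A = z - \sum_(a in A) a], unless [e A] is 0 or lies in [A] or [neg A]. *)
Lemma generic_le_reps m z : z != 0 ->
  (#|generic m.+1| <= m.+2 * #|reps m.+2 z| + 3 * N ^ m)%N.
Proof.
move=> z0; pose e A := z - \sum_(a in A) a.
pose ok := [set A in generic m.+1 | [&& e A \notin A, - e A \notin A & e A != 0]].
have le1 : (#|ok| <= m.+2 * #|reps m.+2 z|)%N.
  rewrite -(@card_marked _ (reps m.+2 z)); last by move=> A /repsP[].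
  apply: (@card_inj_le _ _ _ _ (fun A => (e A |: A, e A))).
    move=> A B; rewrite !inE => /andP[_ /andP[aA _]] /andP[_ /andP[bB _]] [AB ab].
    by rewrite -ab in AB bB *; rewrite -(setU1K aA) AB setU1K.
  move=> A; rewrite inE => /andP[/genericP[cA fA] /and3P[aA naA a0]].
  rewrite inE /= setU11 andbT; apply/repsP.
  by rewrite cardsU1 aA cA antipode_freeU1// sumU1// subrK.
(* If [e A = 0], then [A] has sum [z]; if [e A] is in [A], then deleting it leaves
   a set that determines [e A] by halving; if [- e A] is in [A], then deleting
   it leaves a set with sum [z]. *)
pose b0 := [set A : {set G} | (#|A| == m.+1) && (\sum_(a in A) a == z)].
have l0 : (#|b0| <= N ^ m)%N by exact: card_sum_eq.
pose f1 A := half (z - \sum_(a in A) a) |: A.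
pose b1 := f1 @: [set A : {set G} | #|A| == m].
have l1 : (#|b1| <= N ^ m)%N.
  exact: leq_trans (leq_imset_card _ _) (card_subsets_le_expn _ _).
pose c2 := [set x : {set G} * G | (x.1 \in [set A : {set G} | (#|A| == m) &&
  (\sum_(a in A) a == z)]) && true].
pose b2 := (fun x : {set G} * G => x.2 |: x.1) @: c2.
have l2 : (#|b2| <= N ^ m)%N.
  apply: leq_trans (leq_imset_card _ _) _.
  rewrite (@card_pairs _ _ _ (fun _ _ => true)).
  (* For [m = 0] the deleted set is empty, and its sum 0 is not [z]. *)
  rewrite sum_nat_const; case: m @c2 @b2 {l1 b1 l0 b0 le1 ok} => [|k] c2 b2.
    have -> : [set A : {set G} | (#|A| == 0%N) && (\sum_(a in A) a == z)] = set0.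
      apply/setP => A; rewrite !inE.
      by rewrite cards_eq0; case: eqP => //= ->; rewrite big_set0 eq_sym (negPf z0).
    by rewrite cards0.
  by rewrite expnSr leq_mul ?card_sum_eq// max_card.
apply: (@leq_trans (#|ok| + (#|b0| + #|b1| + #|b2|))); last by lia.
apply: (@leq_trans #|ok :|: (b0 :|: b1 :|: b2)|); last first.
  apply: leq_trans (leq_card_setU _ _) _; rewrite leq_add2l.
  apply: leq_trans (leq_card_setU _ _) _; rewrite leq_add2r.
  exact: leq_card_setU.
apply: subset_leq_card; apply/fintype.subsetP => A /[dup] Ag /genericP[cA fA].
rewrite !in_setU [A \in ok]inE Ag /=.
have [eA|_] := boolP (e A \in A).
  apply/orP; right; apply/orP; left; apply/orP; right; apply/imsetP; exists (A :\ e A).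
    by rewrite inE (cardD1_mem cA).
  rewrite -[in LHS](setD1K eA) /f1; congr (_ |: _); apply: half_uniq.
  by rewrite sumD1// opprB addrCA.
have [eA|_] := boolP (- e A \in A).
  apply/orP; right; apply/orP; right; apply/imsetP; exists (A :\ - e A, - e A).
    have sz : \sum_(a in A) a + e A = z by rewrite addrC subrK.
    rewrite !inE /= andbT sumD1// opprK sz eqxx andbT.
    by rewrite (cardD1_mem cA).
  by rewrite /= setD1K.
have [eA|//] := eqVneq (e A) 0.
by rewrite [A \in b0]inE cA eqxx /= -[_ == z]subr_eq0 -oppr_eq0 opprB -/(e A) eA eqxx.
Qed.

Lemma reps_fact_ge m z : z != 0 ->
  (N ^ m.+1 <= m.+2`! * #|reps m.+2 z| + (3 * m.+1`! + m.+1 ^ 2) * N ^ m)%N.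
Proof.
move=> z0; have := card_generic_ge m; have := generic_le_reps m z0.
rewrite (factS m.+1); move: (m.+1`!)%N (N ^ m)%N (N ^ m.+1)%N => f P Q h1.
by have := leq_mul (leqnn f) h1; nia.
Qed.

(** Changing the signs of [A :\: B] changes the sum by twice the sum over
    [A :\: B]. *)
Lemma flip_sums m z z' A B : A \in reps m z -> B \in reps m z' -> overlap A B = m ->
  \sum_(a in A :\: B) a = half (z - z') /\
  \sum_(a in A :&: B) a = z - half (z - z').
Proof.
move=> /repsP[cA fA sA] /repsP[cB fB sB] oAB.
have EB : B = (A :&: B) :|: neg (A :\: B).
  by apply: flip_decomposition oAB; apply/genericP.
have sB' : z' = \sum_(a in A :&: B) a - \sum_(a in A :\: B) a.
  rewrite -sB (big_setID A) /= [B :&: A]setIC; congr (_ + _).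
  have -> : B :\: A = neg (A :\: B).
    apply/setP => x; rewrite mem_neg !in_setD; move/setP/(_ x): EB.
    rewrite in_setU in_setI mem_neg in_setD.
    have [xA|xA] /= := boolP (x \in A); last by [].
    by rewrite (negPf (antipode_freeP _ fA _ xA)) andbF.
  rewrite big_imset /= ?sumrN// => x y _ _; exact: oppr_inj.
have sA' : z = \sum_(a in A :&: B) a + \sum_(a in A :\: B) a.
  by rewrite -sA (big_setID B).
have h : \sum_(a in A :\: B) a = half (z - z').
  by apply: half_uniq; rewrite sA' sB' opprB [X in _ = X + _]addrC addrACA subrr addr0.
split=> //; by rewrite -h [in RHS]sA' addrK.
Qed.

(** With all classes in common, [B] is [A] with the signs of a part [U] changed.
    Here [U] is nonempty as [A != B], and not all of [A] as [z' != - z], so that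
    the sums over [U] and over its complement are two independent constraints. *)
Lemma card_overlap_full m z z' : z' != - z ->
  (#|[set x : {set G} * {set G} | [&& x.1 \in reps m.+2 z, x.2 \in reps m.+2 z',
      x.1 != x.2 & overlap x.1 x.2 == m.+2]]| <= m.+2 * N ^ m)%N.
Proof.
move=> zz'; set h := half (z - z').
pose X := [set x : {set G} * {set G} | [&& x.1 != set0, x.2 != set0,
   (#|x.1| + #|x.2| == m.+2)%N, \sum_(a in x.1) a == h & \sum_(a in x.2) a == z - h]].
apply: (@leq_trans #|X|).
  apply: (@card_inj_le _ _ _ _ (fun x : {set G} * {set G} => (x.1 :\: x.2, x.1 :&: x.2))).
    move=> [A B] [A' B']; rewrite inE /= => /and4P[/repsP[? ? _] /repsP[? ? _] _ /eqP o].
    rewrite inE /= => /and4P[/repsP[? ? _] /repsP[? ? _] _ /eqP o'] [h1 h2].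
    have Ag : A \in generic m.+2 by apply/genericP.
    have Bg : B \in generic m.+2 by apply/genericP.
    have Ag' : A' \in generic m.+2 by apply/genericP.
    have Bg' : B' \in generic m.+2 by apply/genericP.
    rewrite (flip_decomposition Ag Bg o) (flip_decomposition Ag' Bg' o') h1 h2.
    by rewrite -[in LHS](setID A B) h1 h2 setID.
  move=> [A B]; rewrite inE /= => /and4P[Az Bz AB /eqP o].
  have [s1 s2] := flip_sums Az Bz o.
  have /repsP[cA fA sA] := Az; have /repsP[cB fB sB] := Bz.
  rewrite inE /= s1 s2 -/h !eqxx !andbT addnC cardsID cA eqxx andbT.
  apply/andP; split; apply/negP => /eqP E.
    case/negP: AB; rewrite eqEcard cA cB leqnn andbT.
    by rewrite -setD_eq0 E.
  move: s2; rewrite E big_set0 => /esym/eqP; rewrite subr_eq0 => /eqP zh.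
  case/negP: zz'; rewrite -[z']opprK eqr_oppLR opprK; apply/eqP.
  have := halfK (z - z'); rewrite -zh => /addrI ->//.
(* The cardinality of the first component is [u.+1]. *)
pose Y u := [set x : {set G} * {set G} |
  (x.1 \in [set U : {set G} | (#|U| == u.+1) && (\sum_(a in U) a == h)]) &&
  ((#|x.2| == (m - u).+1) && (\sum_(a in x.2) a == z - h))].
apply: (@leq_trans (\sum_(u < m.+1) #|Y u|)).
  rewrite -sum1_card.
  pose f (x : {set G} * {set G}) : 'I_m.+1 := inord #|x.1|.-1.
  rewrite (partition_big f xpredT)//=; apply: leq_sum => u _.
  rewrite sum1dep_card; apply: subset_leq_card; apply/fintype.subsetP => -[U W].
  rewrite !inE /= => /andP[/and5P[U0 W0 /eqP cUW -> ->] /eqP fu].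
  rewrite -!cards_eq0 in U0 W0.
  rewrite -!lt0n in U0 W0.
  have uU : #|U|.-1 = u.
    rewrite -fu /f inordK//=; move: cUW U0 W0; move: #|U| #|W| => i j; lia.
  rewrite !andbT -uU; move: cUW U0 W0; move: #|U| #|W| => i j *.
  apply/andP; split; apply/eqP; lia.
apply: (@leq_trans (\sum_(u < m.+1) N ^ m)); last by rewrite sum_nat_const card_ord leq_mul.
apply: leq_sum => u _.
have um : (u <= m)%N by rewrite -ltnS.
rewrite (@card_pairs _ _ _ (fun U W => (#|W| == (m - u).+1) && (\sum_(a in W) a == z - h))).
rewrite sum_nat_const -[in leqRHS](subnKC um) expnD leq_mul// ?card_sum_eq//.
Qed.

End AbelianGroup.

(** * Inversion classes and covered elements *)

Section Classes.
Import mathcomp.boot.finset.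
Context {G : finZmodType}.
Implicit Types (A B : {set G}) (a b x y z : G) (act C : {set inversion_class G})
  (xi : inversion_class G).
Local Notation N := #|G|.

Lemma inversion_classP (xi : inversion_class G) a : a \in val xi ->
  val xi = [set a; - a] /\ a != 0.
Proof.
have /imsetP[b b0 ->] := valP xi; rewrite !inE in b0 *.
case/orP => /eqP ->; rewrite ?oppr_eq0 b0; split=> //.
by rewrite opprK setUC.
Qed.

Lemma inversion_class_ex a : a != 0 -> exists xi : inversion_class G, a \in val xi.
Proof.
move=> a0; have H : [set a; - a] \in inversion_classes G.
  by apply: imset_f; rewrite !inE.
by exists (exist (fun S => S \in inversion_classes G) _ H); rewrite /= !inE eqxx.
Qed.

Lemma inversion_class_inj (xi xi' : inversion_class G) a :
  a \in val xi -> a \in val xi' -> xi = xi'.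
Proof.
move=> /inversion_classP[h _] /inversion_classP[h' _].
by apply: val_inj; rewrite h h'.
Qed.

Lemma connection_setP act a :
  reflect (exists2 xi, xi \in act & a \in val xi) (a \in connection_set act).
Proof. exact: bigcupP. Qed.

Lemma connection_set_n0 act : 0 \notin connection_set act.
Proof.
by apply/negP => /connection_setP[xi _ /inversion_classP[_]]; rewrite eqxx.
Qed.

Lemma mem_inversion_classN (xi : inversion_class G) a :
  (- a \in val xi) = (a \in val xi).
Proof.
apply/idP/idP => /[dup] /inversion_classP[-> _] _; rewrite !inE ?opprK eqxx ?orbT//.
Qed.

Lemma connection_setN act a : (- a \in connection_set act) = (a \in connection_set act).
Proof.
apply/connection_setP/connection_setP => -[xi xia axi]; exists xi => //.
  by rewrite mem_inversion_classN in axi.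
by rewrite mem_inversion_classN.
Qed.

Lemma connection_setS act act' : act \subset act' ->
  connection_set act \subset connection_set act'.
Proof.
move=> aa'; apply/fintype.subsetP => a /connection_setP[xi xia axi].
by apply/connection_setP; exists xi => //; exact: (fintype.subsetP aa').
Qed.

Lemma card_connection_set act : (#|connection_set act| <= 2 * #|act|)%N.
Proof.
apply: (@leq_trans (\sum_(xi in act) #|val xi|)).
  rewrite /connection_set; elim/big_rec2: _ => [|xi m B _ mB]; first by rewrite cards0.
  by apply: leq_trans (leq_card_setU _ _) _; rewrite leq_add2l.
rewrite mulnC -sum_nat_const; apply: leq_sum => xi _.
have /imsetP[b _ ->] := valP xi; rewrite cards2; by case: (_ != _).
Qed.

Definition classes_of B : {set inversion_class G} :=
  [set xi : inversion_class G | val xi :&: B != set0].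

Lemma classes_ofP B xi :
  reflect (exists2 b, b \in B & b \in val xi) (xi \in classes_of B).
Proof.
rewrite inE; apply: (iffP (set0Pn _)) => [[b]|[b bB bx]].
  by rewrite inE => /andP[bx bB]; exists b.
by exists b; rewrite inE bx.
Qed.

Lemma classes_of_sub B act : 0 \notin B ->
  (classes_of B \subset act) = (B \subset connection_set act).
Proof.
move=> B0; apply/fintype.subsetP/fintype.subsetP => H.
  move=> b bB; have [xi bxi] : exists xi : inversion_class G, b \in val xi.
    by apply: inversion_class_ex; apply: contraNneq B0 => <-.
  apply/connection_setP; exists xi => //; apply: H; apply/classes_ofP; by exists b.
move=> xi /classes_ofP[b /H /connection_setP[xi' xia bx'] bx].
by rewrite (inversion_class_inj bx bx').
Qed.

Lemma card_classes_of B : antipode_free B -> #|classes_of B| = #|B|.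
Proof.
move=> fB; have B0 := antipode_free_n0 fB.
transitivity #|[set [set b; - b] | b in B]|; last first.
  apply: card_in_imset => a b aB bB /setP /(_ b); rewrite !inE eqxx /=.
  case: eqVneq => [->//|_] /=; case: eqVneq => // bb.
  by have := antipode_freeP _ fB _ aB; rewrite -bb bB.
rewrite -(card_imset _ (@val_inj _ _ (inversion_class G))) /=.
congr #|pred_of_set _|; apply/setP => S; apply/imsetP/imsetP => [[xi]|[b bB ->]].
  by move=> /classes_ofP[b bB /inversion_classP[h _]] ->; exists b.
have [xi bxi] : exists xi : inversion_class G, b \in val xi.
  by apply: inversion_class_ex; apply: contraNneq B0 => <-.
exists xi; first by apply/classes_ofP; exists b.
by case: (inversion_classP bxi).
Qed.

Lemma antipode_freeS A B : A \subset B -> antipode_free B -> antipode_free A.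
Proof.
move=> AB /antipode_freeP fB; apply/antipode_freeP => a aA.
by apply: contra (fB a (fintype.subsetP AB a aA)); exact: (fintype.subsetP AB).
Qed.

Lemma card_classes_ofI A B : antipode_free B ->
  #|classes_of A :&: classes_of B| = overlap A B.
Proof.
move=> fB; rewrite /overlap -card_classes_of; last first.
  by apply: antipode_freeS fB; exact: subsetIl.
congr #|pred_of_set _|; apply/setP => xi; rewrite inE; apply/andP/classes_ofP.
  move=> [/classes_ofP[a aA ax] /classes_ofP[b bB bx]]; exists b => //.
  rewrite !inE bB mem_neg /=.
  have [h _] := inversion_classP ax; move: bx; rewrite h !inE.
  by case/orP => /eqP ->; rewrite ?opprK aA ?orbT.
move=> [b]; rewrite !inE mem_neg => /andP[bB /orP[bA|bA]] bx.
  by split; apply/set0Pn; exists b; rewrite inE bx.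
split; apply/set0Pn; [exists (- b)|exists b]; rewrite inE ?mem_inversion_classN bx//.
Qed.

Lemma card_classes_ofU A B : antipode_free A -> antipode_free B ->
  #|classes_of A :|: classes_of B| = (#|A| + #|B| - overlap A B)%N.
Proof.
by move=> fA fB; rewrite cardsU card_classes_ofI// !card_classes_of.
Qed.

Lemma meet_classes_of A B : antipode_free B -> meet classes_of A B = (0 < overlap A B)%N.
Proof.
by move=> fB; rewrite /meet -setI_eq0 -card_classes_ofI// card_gt0.
Qed.

(** Allowing 0 among the [d] summands gives the sums of at most [d] elements. *)
Definition covered d act z :=
  [exists f : {ffun 'I_d -> G},
    [forall i, f i \in 0 |: connection_set act] && (\sum_i f i == z)].

Lemma coveredP d act z : reflect
  (exists2 f : {ffun 'I_d -> G}, forall i, f i \in 0 |: connection_set act & \sum_i f i = z)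
  (covered d act z).
Proof.
apply: (iffP existsP) => [[f /andP[/forallP h /eqP s]]|[f h s]]; first by exists f.
by exists f; rewrite s eqxx andbT; apply/forallP.
Qed.

Lemma coveredS d act act' z : act \subset act' -> covered d act z -> covered d act' z.
Proof.
move=> aa' /coveredP[f fa fs]; apply/coveredP; exists f => // i.
by apply: (fintype.subsetP _ _ (fa i)); apply/finset.setUS/connection_setS.
Qed.

Lemma coveredN d act z : covered d act (- z) = covered d act z.
Proof.
suff H y : covered d act y -> covered d act (- y).
  by apply/idP/idP => /H //; rewrite opprK.
move=> /coveredP[f fa <-]; apply/coveredP; exists [ffun i => - f i].
  move=> i; have := fa i; rewrite ffunE !in_setU1 oppr_eq0.
  by rewrite connection_setN.
by rewrite -sumrN; apply: eq_bigr => i _; rewrite ffunE.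
Qed.

Lemma reps_covered d act z A : A \in reps d z -> classes_of A \subset act ->
  covered d act z.
Proof.
move=> /repsP[cA fA sA]; rewrite classes_of_sub ?antipode_free_n0// => Aact.
apply/coveredP; exists [ffun i : 'I_d => nth 0 (enum A) i].
  move=> i; rewrite ffunE in_setU1; apply/orP; right; apply: (fintype.subsetP Aact).
  by rewrite -mem_enum mem_nth// -cardE cA.
under eq_bigr do rewrite ffunE.
by rewrite -sA -[RHS]big_enum [RHS](big_nth 0) big_mkord -cardE cA.
Qed.

Lemma card_covered_le d C : (#|C| < d)%N ->
  (#|[set z | covered d C z]| <= (2 * d) ^ d)%N.
Proof.
move=> Cd; pose D := 0 |: connection_set C.
pose sum (f : {ffun 'I_d -> G}) : G := \sum_i f i.
apply: (@leq_trans #|sum @: [set f : {ffun 'I_d -> G} | f \in ffun_on D]|).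
  apply: subset_leq_card; apply/fintype.subsetP => z; rewrite inE => /coveredP[f fD fs].
  by apply/imsetP; exists f => //; rewrite inE; apply/ffun_onP.
apply: leq_trans (leq_imset_card _ _) _; rewrite cardsE card_ffun_on card_ord.
rewrite leq_exp2r ?(leq_ltn_trans _ Cd)// cardsU1; have := card_connection_set C.
by rewrite connection_set_n0; lia.
Qed.

Hypothesis Godd : odd #|G|.

(** When the summands involve fewer than [d] classes, these classes already cover
    [z]; otherwise the summands are distinct, nonzero and never opposite. *)
Lemma covered_dichotomy d act z : covered d act z ->
  (exists2 A, A \in reps d z & classes_of A \subset act) \/
  (exists C : {set inversion_class G}, [/\ C \subset act, (#|C| < d)%N & covered d C z]).
Proof.
move=> /coveredP[f fa fs]; pose F := [set f i | i in 'I_d].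
pose C := classes_of F.
have FC i : f i \in 0 |: connection_set C.
  rewrite in_setU1; have [//|fi0] := eqVneq (f i) 0.
  have [xi fxi] := inversion_class_ex fi0.
  by apply/connection_setP; exists xi => //; apply/classes_ofP; exists (f i) => //; exact: imset_f.
have Cact : C \subset act.
  apply/fintype.subsetP => xi /classes_ofP[_ /imsetP[i _ ->]] fxi.
  have := fa i; rewrite in_setU1; case/orP.
    by move=> /eqP fi0; have [_] := inversion_classP fxi; rewrite fi0 eqxx.
  by move=> /connection_setP[xi' xia fxi']; rewrite (inversion_class_inj fxi fxi').
have [Cd|Cd] := ltnP #|C| d; first by right; exists C; split=> //; apply/coveredP; exists f.
(* The [d] summands then meet at least [d] classes, so they are nonzero and have
   distinct classes. *)
left.
pose h i : {set G} := [set f i; - f i].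
pose I1 := [set i : 'I_d | f i != 0].
have hC : val @: C \subset h @: I1.
  apply/fintype.subsetP => _ /imsetP[xi /classes_ofP[_ /imsetP[i _ ->] fxi] ->].
  have [-> fi0] := inversion_classP fxi.
  by apply/imsetP; exists i => //; rewrite inE.
have := subset_leq_card hC; rewrite (card_imset _ (@val_inj _ _ (inversion_class G))).
move=> Ch; have {Cd}Ch := leq_trans Cd Ch.
have I1d : #|I1| = d.
  apply/eqP; rewrite eqn_leq (leq_trans Ch (leq_imset_card _ _)) andbT.
  by rewrite -[leqRHS]card_ord max_card.
have I1T : I1 = [set: 'I_d].
  by apply/eqP; rewrite eqEcard finset.subsetT cardsT card_ord I1d leqnn.
have hinj : {in I1 &, injective h}.
  apply/imset_injP; rewrite eqn_leq leq_imset_card I1d//.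
have f0 i : f i != 0 by have := finset.in_setT i; rewrite -I1T inE.
have finj : injective f.
  by move=> i j fij; apply: hinj; rewrite ?I1T ?inE// /h fij.
exists F; last by rewrite -/C.
apply/repsP; split.
- by rewrite card_imset// card_ord.
- apply/antipode_freeP => _ /imsetP[i _ ->]; apply/negP => /imsetP[j _ fij].
  have : h i = h j by rewrite /h -fij opprK finset.setUC.
  move/hinj; rewrite I1T !inE => /(_ isT isT) ij.
  by have := opp_neq Godd (f0 i); rewrite fij -ij eqxx.
- rewrite big_imset/=; last by move=> i j _ _; exact: finj.
  by rewrite -fs; apply: eq_bigl => i; rewrite inE.
Qed.

(** A representative; the default value 0 is never used since classes are
    nonempty. *)
Definition class_elt (xi : inversion_class G) : G := odflt 0 [pick a in val xi].

Lemma mem_class_elt xi : class_elt xi \in val xi.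
Proof.
rewrite /class_elt; case: pickP => //= h.
by have /imsetP[b _ E] := valP xi; have := h b; rewrite E !inE eqxx.
Qed.

Lemma class_elt_neq0 xi : class_elt xi != 0.
Proof. by case: (inversion_classP (mem_class_elt xi)). Qed.

Lemma class_elt_inj : injective class_elt.
Proof.
by move=> xi xi' h; apply: (inversion_class_inj (mem_class_elt xi)); rewrite h mem_class_elt.
Qed.

Lemma antipode_free_class_elt (S : {set inversion_class G}) :
  antipode_free [set class_elt xi | xi in S].
Proof.
apply/antipode_freeP => _ /imsetP[xi _ ->]; apply/negP => /imsetP[xi' _ h].
have : xi = xi'.
  apply: (@inversion_class_inj _ _ (- class_elt xi)); last by rewrite h mem_class_elt.
  by rewrite mem_inversion_classN mem_class_elt.
by move=> xx; have := opp_neq Godd (class_elt_neq0 xi); rewrite h xx eqxx.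
Qed.

Lemma card_inversion_class : (2 * #|{: inversion_class G}| = N.-1)%N.
Proof.
have -> : N.-1 = #|[set~ (0 : G)]|.
  by rewrite cardsC1.
have -> : #|{: inversion_class G}| = #|inversion_classes G| by rewrite card_sig.
have cl2 S : S \in inversion_classes G -> #|S| = 2%N.
  by move=> /imsetP[a]; rewrite !inE => a0 ->; rewrite cards2 eq_sym opp_neq.
rewrite (@card_partition _ (inversion_classes G)).
  by rewrite (eq_bigr _ cl2) sum_nat_const mulnC.
apply/and3P; split.
- rewrite /cover; apply/eqP/setP => a; rewrite !inE; apply/bigcupP/idP.
    by move=> [S /imsetP[b]]; rewrite !inE => b0 ->; rewrite !inE => /orP[]/eqP->; rewrite ?oppr_eq0.
  by move=> a0; have [xi axi] := inversion_class_ex a0; exists (val xi) => //; exact: valP.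
- apply/trivIsetP => S S' hS hS'; apply: contraR => /pred0Pn[a /= /andP[aS aS']].
  by have := @inversion_class_inj (Sub S hS) (Sub S' hS') a aS aS' => /(congr1 val) /= ->.
- by apply/negP => /cl2; rewrite cards0.
Qed.

Lemma natr_card_inversion_class (R : realType) :
  2 * #|{: inversion_class G}|%:R + 1 = N%:R :> R.
Proof.
rewrite -natrM card_inversion_class -[X in _ + X]/(1%:R) -natrD addn1 prednK//.
by apply/card_gt0P; exists 0.
Qed.

End Classes.

(** * Probabilities of staying uncovered *)

Section Estimates.
Import mathcomp.boot.finset.
Context {R : realType} {G : finZmodType} (m : nat) (p : R).
Hypotheses (Godd : odd #|G|) (p0 : 0 <= p) (p1 : p <= 1).
Implicit Types (A B : {set G}) (x y z : G).
Local Notation N := #|G|.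
Local Notation d := m.+2.
Local Notation u := (N%:R * p).
Local Notation lam := (N%:R ^+ m.+1 * p ^+ d / d`!%:R).
Local Notation eps := (u ^+ (2 * d).-1 / N%:R ^+ 2).

Hypothesis u1 : 1 <= u.

Lemma cardG_gt0 : 0 < N%:R :> R.
Proof. by rewrite ltr0n; apply/card_gt0P; exists 0. Qed.

Lemma eps_ge0 : 0 <= eps.
Proof. by rewrite mulr_ge0 ?invr_ge0 ?exprn_ge0 ?(le_trans ler01 u1) ?(ltW cardG_gt0). Qed.

(** The left side is [u ^ (2 d - k) / N ^ 2], largest when a single class is shared
    because [1 <= u]. *)
Lemma overlap_weight k : (0 < k <= d)%N ->
  N%:R ^+ (2 * d - k - 2) * p ^+ (2 * d - k) <= eps.
Proof.
move=> /andP[k0 kd]; rewrite ler_pdivlMr ?exprn_gt0 ?cardG_gt0//.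
rewrite mulrAC -exprD (_ : (2 * d - k - 2 + 2)%N = (2 * d - k)%N); last by lia.
by rewrite -exprMn ler_weXn2l//; lia.
Qed.

(** The correlation term of Janson's inequality for a pair of targets, grouped by
    the number of shared classes. *)
Lemma pair_sum_le z z' : z' != - z ->
  \sum_(A in reps d z) \sum_(B in reps d z' | (B != A) && (0 < overlap A B)%N)
     p ^+ (2 * d - overlap A B) <= (d * 4 ^ d)%:R * eps.
Proof.
move=> zz'.
pose Q k := [set x : {set G} * {set G} | [&& x.1 \in reps d z, x.2 \in reps d z',
      x.1 != x.2 & overlap x.1 x.2 == k]].
have cQ k : (0 < k <= d)%N -> (#|Q k| <= 4 ^ d * N ^ (2 * d - k - 2))%N.
  move=> /andP[k0]; rewrite leq_eqVlt => /orP[/eqP ->|kd].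
    apply: leq_trans (card_overlap_full Godd _ zz') _.
    apply: leq_mul; last by rewrite (_ : (2 * d - d - 2 = m)%N)//; lia.
    by apply: leq_trans (ltnW (ltn_expl d _)) _ => //; rewrite leq_exp2r.
  rewrite (_ : (2 * d - k - 2 = m.+1 + (m.+1 - k))%N); last by lia.
  have km : (k <= m.+1)%N by rewrite -ltnS.
  refine (leq_trans _ (@card_overlap_lt G m.+1 k z z' km)).
  apply: subset_leq_card; apply/fintype.subsetP => x; rewrite !inE.
  by move=> /and4P[-> -> _ ->].
have -> : \sum_(A in reps d z) \sum_(B in reps d z' | (B != A) && (0 < overlap A B)%N)
     p ^+ (2 * d - overlap A B) = \sum_(k < d) #|Q k.+1|%:R * p ^+ (2 * d - k.+1).
  rewrite pair_big_dep /=.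
  rewrite (partition_big
    (fun x : {set G} * {set G} => inord (overlap x.1 x.2).-1 : 'I_d) xpredT)//=.
  apply: eq_bigr => k _.
  rewrite mulr_natl -sumr_const; apply: eq_big => [[A B]|[A B]] /=.
    rewrite [_ \in Q _]inE /= [B == A]eq_sym -!andbA; congr (_ && _).
    case: (boolP (B \in _)) => //= /repsP[cB _ _]; congr (_ && _).
    have oB : (overlap A B <= d)%N by rewrite -cB subset_leq_card// subsetIl.
    apply/andP/eqP => [[pos /eqP <-]|o].
      by rewrite inordK ?prednK//; move: oB pos; case: (overlap A B).
    by rewrite o; split=> //; apply/eqP/val_inj; rewrite /= inordK.
  move=> /andP[/andP[_ /andP[/repsP[cB _ _] /andP[_ pos]]] /eqP <-].
  have oB : (overlap A B <= d)%N by rewrite -cB subset_leq_card// subsetIl.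
  by rewrite inordK ?prednK//; move: oB pos; case: (overlap A B).
rewrite natrM -mulrA mulr_natl -[X in _ *+ X]card_ord -sumr_const; apply: ler_sum => k _.
have kd : (0 < k.+1 <= d)%N by rewrite ltn_ord.
apply: (@le_trans _ _ ((4 ^ d)%:R * (N%:R ^+ (2 * d - k.+1 - 2) * p ^+ (2 * d - k.+1)))).
  rewrite mulrA ler_wpM2r ?exprn_ge0// -natrX -natrM ler_nat; exact: cQ.
by rewrite ler_wpM2l// overlap_weight.
Qed.

Local Notation Pr X := (bern_mean p (fun act => (X act)%:R)).

(** The defect of the mean in [reps_mean_ge] plus the correlation constant of
    [pair_sum_le]. *)
Definition uncovered_const : nat := (3 * m.+1`! + m.+1 ^ 2) + d * 4 ^ d.

(** The completions lost in [reps_fact_ge] cost one power of [N], so the mean number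
    of active generic representations falls short of [lam] by [O(eps)] at most. *)
Lemma reps_mean_ge z : z != 0 ->
  lam - (3 * m.+1`! + m.+1 ^ 2)%:R * eps <= #|reps d z|%:R * p ^+ d.
Proof.
move=> z0; have w : N%:R ^+ m * p ^+ d <= eps.
  have := @overlap_weight d; rewrite leqnn (_ : (2 * d - d - 2 = m)%N); last lia.
  by rewrite (_ : (2 * d - d = d)%N); [apply|lia].
have := reps_fact_ge Godd m z0; have := fact_gt0 d.
move: (d`!)%N (3 * m.+1`! + m.+1 ^ 2)%N eps w eps_ge0 => f K e w e0 f1.
rewrite -(ler_nat R) natrD !natrM !natrX => h.
have f0 : 0 < f%:R :> R by rewrite ltr0n.
have {f1}f1 : 1 <= f%:R :> R by rewrite ler1n.
have K0 : 0 <= K%:R :> R by [].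
have := ler_wpM2r (exprn_ge0 d p0) h; rewrite mulrDl => {}h.
rewrite -(ler_pM2r f0) mulrBl divfK ?gt_eqF//.
have : K%:R * (N%:R ^+ m * p ^+ d) <= K%:R * e * f%:R.
  apply: (@le_trans _ _ (K%:R * e)); first by rewrite ler_wpM2l.
  by rewrite ler_peMr// mulr_ge0.
rewrite mulrA [_ * f%:R]mulrAC -[X in _ <= X]mulrA; move: h; rewrite -[f%:R * _ * _]mulrA.
lra.
Qed.

(** Janson's inequality for the generic representations of all elements of [Z].
    That [Z] is antipode-free gives both [z != 0] and [z' != - z] for all
    [z, z'] in [Z], including [z = z']. *)
Lemma Pr_all_uncovered_le (Z : {set G}) : antipode_free Z ->
  Pr (fun act => [forall z in Z, ~~ covered d act z]) <=
  expR (- (#|Z|%:R * lam) + #|Z|%:R ^+ 2 * (uncovered_const%:R * eps)).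
Proof.
move=> fZ.
pose F := [set A | (A \in generic d) && (\sum_(a in A) a \in Z)].
have FE (g : {set G} -> R) : \sum_(A in F) g A = \sum_(z in Z) \sum_(A in reps d z) g A.
  rewrite (partition_big (fun A : {set G} => \sum_(a in A) a) (mem Z)) /=; last first.
    by move=> A; rewrite inE => /andP[].
  apply: eq_bigr => z zZ; apply: eq_bigl => A; rewrite [A \in F]inE [A \in reps _ _]inE.
  by case: eqP => [->|]; rewrite ?zZ ?andbT ?andbF.
have Z0 z : z \in Z -> z != 0.
  by move=> zZ; apply: contraNneq (antipode_free_n0 fZ) => <-.
apply: (@le_trans _ _ (Pr (avoid (@classes_of G) (enum F)))).
  apply: le_bern_mean => // act; rewrite ler_nat.
  have [/forall_inP H|//] := boolP [forall z in Z, ~~ covered d act z].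
  rewrite (_ : avoid _ _ _)//; apply/allP => A; rewrite mem_enum inE => /andP[Ag sA].
  apply: contra (H _ sA) => Aact; apply: reps_covered Aact.
  by rewrite inE Ag eqxx.
apply: le_trans (janson p0 p1 (@classes_of G) (enum_uniq F)) _.
rewrite ler_expR.
have -> : \sum_(A <- enum F) p ^+ #|classes_of A| = \sum_(z in Z) #|reps d z|%:R * p ^+ d.
  rewrite big_enum FE; apply: eq_bigr => z _.
  under eq_bigr => A /repsP[cA fA _] do rewrite card_classes_of// cA.
  by rewrite sumr_const mulr_natl.
have -> : \sum_(i <- enum F) \sum_(j <- enum F | (j != i) && meet (@classes_of G) i j)
      p ^+ #|classes_of i :|: classes_of j| =
    \sum_(z in Z) \sum_(z' in Z) \sum_(A in reps d z)
      \sum_(B in reps d z' | (B != A) && (0 < overlap A B)%N) p ^+ (2 * d - overlap A B).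
  rewrite big_enum FE; apply: eq_bigr => z zZ; rewrite exchange_big /=; apply: eq_bigr => A.
  move=> /repsP[cA fA _]; rewrite big_enum_cond /= big_mkcondr FE.
  apply: eq_bigr => z' _; rewrite -big_mkcondr /=.
  apply: eq_big => [B|B /andP[/repsP[cB fB _] _]].
    by case: (boolP (B \in _)) => //= /repsP[_ fB _]; rewrite meet_classes_of.
  by rewrite card_classes_ofU// cA cB addnn mul2n.
set T := \sum_(z in Z) _; set S := \sum_(z in Z) _.
have S1 : #|Z|%:R * (lam - (3 * m.+1`! + m.+1 ^ 2)%:R * eps) <= S.
  rewrite mulr_natl -sumr_const; apply: ler_sum => z zZ.
  by apply: reps_mean_ge; exact: Z0.
have T1 : T <= #|Z|%:R ^+ 2 * ((d * 4 ^ d)%:R * eps).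
  rewrite expr2 -mulrA mulr_natl -sumr_const; apply: ler_sum => z zZ.
  rewrite mulr_natl -sumr_const; apply: ler_sum => z' zZ'.
  apply: pair_sum_le; apply: contraTneq zZ' => ->.
  exact: (antipode_freeP _ fZ).
have Z2 : (#|Z|%:R : R) <= #|Z|%:R ^+ 2
  by rewrite -natrX ler_nat; case: #|Z| => // k; rewrite expnS expn1 leq_pmulr.
have K0 : 0 <= (3 * m.+1`! + m.+1 ^ 2)%:R * eps by rewrite mulr_ge0// eps_ge0.
have := ler_wpM2r K0 Z2.
rewrite /uncovered_const (natrD _ (3 * m.+1`! + m.+1 ^ 2)%N) [X in _ + _ ^+ 2 * X]mulrDl.
move: S1 T1; move: ((3 * m.+1`! + m.+1 ^ 2)%:R * eps) ((d * 4 ^ d)%:R * eps) => a b.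
move: lam => l.
lra.
Qed.

Hypothesis p1' : p < 1.

(** A family of fewer than [d] classes covers at most [(2 d) ^ d] elements, and it
    has fewer than [d] possible cardinalities. *)
Definition small_const : nat := (2 * d) ^ d * d.

Lemma small_sets_sum :
  \sum_(C : {set inversion_class G} | (#|C| < d)%N) p ^+ #|C| <= d%:R * u ^+ m.+1.
Proof.
rewrite (partition_big (fun C : {set inversion_class G} => inord #|C| : 'I_d) xpredT)//=.
rewrite mulr_natl -[X in _ *+ X]card_ord -sumr_const; apply: ler_sum => k _.
apply: (@le_trans _ _ (\sum_(C : {set inversion_class G} | #|C| == k) p ^+ k)).
  rewrite le_eqVlt; apply/orP; left; apply/eqP; apply: eq_big => C.
    apply/andP/eqP => [[Cd /eqP <-]|->]; first by rewrite inordK.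
    by rewrite ltn_ord; split=> //; apply/eqP/val_inj; rewrite /= inordK.
  by move=> /andP[Cd /eqP <-]; rewrite inordK.
rewrite sumr_const -[leLHS]mulr_natl.
apply: (@le_trans _ _ (u ^+ k)); last by rewrite ler_weXn2l// -ltnS.
rewrite exprMn ler_wpM2r ?exprn_ge0// -natrX ler_nat.
rewrite -cardsE; apply: leq_trans (card_subsets_le_expn _ _) _.
case: (val k) => // j; rewrite leq_exp2r//.
have := card_inversion_class Godd; lia.
Qed.

(** This follows from [(1 - q)^-1 = 1 + q / (1 - q) <= expR (q / (1 - q))]. *)
Lemma exp_le_pow (q : R) n : 0 <= q -> q < 1 -> expR (- (n%:R * q / (1 - q))) <= (1 - q) ^+ n.
Proof.
move=> q0 q1; rewrite -[in leLHS]mulrA -mulrN expRM_natl.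
apply: lerXn2r; rewrite ?nnegrE ?expR_ge0 ?subr_ge0 ?(ltW q1)//.
rewrite expRN -[leRHS]invrK lef_pV2 ?posrE ?expR_gt0 ?invr_gt0 ?subr_gt0//.
apply: le_trans (expR_ge1Dx _).
rewrite le_eqVlt; apply/orP; left; apply/eqP; field.
by rewrite gt_eqF// subr_gt0.
Qed.

(** Two decreasing events make [z] uncovered: no generic representation is active,
    and no family of fewer than [d] active classes covers [z].  Harris's
    inequality multiplies their probabilities, and the second one is estimated by
    a union bound. *)
Lemma Pr_uncovered_ge z :
  expR (- (lam / (1 - p ^+ d))) *
  (1 - \sum_(C : {set inversion_class G} | (#|C| < d)%N && covered d C z) p ^+ #|C|) <=
  Pr (fun act => ~~ covered d act z).
Proof.
set D := \sum_(C | _) _.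
have q1 : p ^+ d < 1 by rewrite exprn_ilt1.
pose small (act : {set inversion_class G}) :=
  [exists C : {set inversion_class G}, [&& C \subset act, (#|C| < d)%N & covered d C z]].
have n2 : 1 - D <= Pr (fun act => ~~ small act).
  have -> : 1 - D = bern_mean p (fun act => 1 -
    \sum_(C : {set inversion_class G} | (#|C| < d)%N && covered d C z) (C \subset act)%:R).
    rewrite bern_meanB bern_mean_cst bern_mean_sum; congr (_ - _).
    by apply: eq_bigr => C _; rewrite bern_mean_superset.
  apply: le_bern_mean => // act; have [/existsP[C /and3P[Ca Cd Cz]]|_] := boolP (small act).
    by rewrite subr_le0 (bigD1 C) ?Cd//= Ca lerDl sumr_ge0.
  by rewrite gerBl sumr_ge0.
have n1 : expR (- (lam / (1 - p ^+ d))) <= Pr (avoid (@classes_of G) (enum (reps d z))).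
  apply: le_trans (Pr_avoid_ge p0 p1 _ _).
  rewrite big_enum /=; under eq_bigr => A /repsP[cA fA _] do rewrite card_classes_of// cA.
  rewrite prodr_const; apply: le_trans (exp_le_pow _ (exprn_ge0 _ p0) q1).
  rewrite ler_expR lerN2 ler_wpM2r ?invr_ge0 ?subr_ge0 ?exprn_ile1//.
  rewrite mulrAC ler_wpM2r ?exprn_ge0// ler_pdivlMr ?ltr0n ?fact_gt0//.
  by rewrite mulrC -natrX -natrM ler_nat reps_fact_le.
apply: (@le_trans _ _ (expR (- (lam / (1 - p ^+ d))) * Pr (fun act => ~~ small act))).
  by rewrite ler_wpM2l ?expR_ge0.
apply: (@le_trans _ _ (Pr (avoid (@classes_of G) (enum (reps d z))) *
  Pr (fun act => ~~ small act))).
  by rewrite ler_wpM2r// bern_mean_ge0.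
apply: le_trans (bern_mean_harris_decr p0 p1 _ _) _.
- exact: nonincr_avoid.
- apply: nonincr_pred => act act' aa'; apply: contra => /existsP[C /and3P[Ca Cd Cz]].
  by apply/existsP; exists C; rewrite Cd Cz (fintype.subset_trans Ca aa').
apply: le_bern_mean => // act; rewrite -natrM mulnb ler_nat.
have [cz|_] := boolP (covered d act z); last by rewrite leq_b1.
rewrite leqn0 eqb0; apply/negP => /andP[/allP av sm].
have [[A Az Aact]|[C [Ca Cd Cz]]] := covered_dichotomy Godd cz.
  by have := av A; rewrite mem_enum Az Aact => /(_ isT).
by case/negP: sm; apply/existsP; exists C; rewrite Ca Cd Cz.
Qed.

(** Exchanging the sums replaces the number of families covering a given [z], which
    may be large, by the number of elements covered by a given family. *)
Lemma sum_Pr_uncovered_ge (S : {set G}) :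
  expR (- (lam / (1 - p ^+ d))) * (#|S|%:R - small_const%:R * u ^+ m.+1) <=
  \sum_(z in S) Pr (fun act => ~~ covered d act z).
Proof.
apply: (@le_trans _ _ (\sum_(z in S) expR (- (lam / (1 - p ^+ d))) *
  (1 - \sum_(C : {set inversion_class G} | (#|C| < d)%N && covered d C z) p ^+ #|C|))).
  rewrite -mulr_sumr ler_wpM2l ?expR_ge0// sumrB sumr_const lerD2l lerN2.
  apply: (@le_trans _ _ (\sum_z
    \sum_(C : {set inversion_class G} | (#|C| < d)%N && covered d C z) p ^+ #|C|)).
    rewrite [leRHS](bigID (mem S)) /= lerDl; apply: sumr_ge0 => z _.
    by apply: sumr_ge0 => C _; exact: exprn_ge0.
  rewrite (exchange_big_dep (fun C : {set inversion_class G} => (#|C| < d)%N)) /=; last first.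
    by move=> z C _ /andP[].
  rewrite /small_const natrM -mulrA; apply: le_trans (ler_wpM2l _ small_sets_sum) => //.
  rewrite mulr_sumr; apply: ler_sum => C Cd.
  rewrite sumr_const -[leLHS]mulr_natl ler_wpM2r ?exprn_ge0// ler_nat.
  refine (leq_trans _ (card_covered_le Cd)); apply: subset_leq_card.
  by apply/fintype.subsetP => z; rewrite !inE unfold_in Cd.
by apply: ler_sum => z _; exact: Pr_uncovered_ge.
Qed.

End Estimates.

(** * The probability that every element is covered *)

Section CoverProbability.
Import mathcomp.boot.finset.
Context {R : realType} {G : finZmodType} (m : nat) (p : R).
Hypotheses (Godd : odd #|G|) (p0 : 0 <= p) (p1 : p < 1).
Local Notation N := #|G|.
Local Notation d := m.+2.
Local Notation u := (N%:R * p).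
Local Notation lam := (N%:R ^+ m.+1 * p ^+ d / d`!%:R).
Local Notation eps := (u ^+ (2 * d).-1 / N%:R ^+ 2).
Local Notation M := (#|{: inversion_class G}|).
Local Notation K := ((uncovered_const m)%:R).

Hypothesis u1 : 1 <= u.

Local Notation Pr X := (bern_mean p (fun act => (X act)%:R)).

Let U (xi : inversion_class G) : pred {set inversion_class G} :=
  fun act => ~~ covered d act (class_elt xi).

Let U_decr xi (A B : {set inversion_class G}) : A \subset B -> U xi B -> U xi A.
Proof. by move=> AB; apply: contra; exact: coveredS. Qed.

Definition all_covered (act : {set inversion_class G}) := [forall z : G, covered d act z].

Lemma all_coveredE : all_covered =1 none U (enum {: inversion_class G}).
Proof.
move=> act; apply/forallP/allP => [H xi _|H z]; first by rewrite negbK H.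
have [->|z0] := eqVneq z 0.
  apply/coveredP; exists [ffun=> 0]; first by move=> i; rewrite ffunE setU11.
  by rewrite big1// => i _; rewrite ffunE.
have [xi zxi] := inversion_class_ex z0.
have := H xi; rewrite mem_enum inE => /(_ isT); rewrite negbK.
have [h _] := inversion_classP (mem_class_elt xi).
by move: zxi; rewrite h !inE => /orP[]/eqP ->; rewrite ?coveredN.
Qed.

Let p1' : p <= 1 := ltW p1.

Let q xi : R := Pr (U xi).

Lemma Pr_uncovered_le xi : q xi <= expR (- lam + K * eps).
Proof.
have fZ : antipode_free [set class_elt xi].
  by rewrite -imset_set1; exact: antipode_free_class_elt.
apply: le_trans (le_trans _ (Pr_all_uncovered_le m Godd p0 p1' u1 fZ)) _.
  apply: le_bern_mean => // act; rewrite ler_nat; case: (boolP (U xi act)) => // Ua.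
  by rewrite (introT forall_inP)// => z; rewrite inE => /eqP ->.
by rewrite cards1 mul1r expr1n mul1r.
Qed.

Lemma Pr_uncovered2_le xi xi' : xi != xi' ->
  Pr [pred act | U xi act && U xi' act] <= expR (- (2 * lam) + 4 * (K * eps)).
Proof.
move=> xx; have fZ : antipode_free [set class_elt xi; class_elt xi'].
  have := antipode_free_class_elt Godd [set xi; xi'].
  by rewrite imsetU !imset_set1.
apply: le_trans (le_trans _ (Pr_all_uncovered_le m Godd p0 p1' u1 fZ)) _.
  apply: le_bern_mean => // act; rewrite ler_nat /=.
  case: (boolP (U xi act)) => // Ua; case: (boolP (U xi' act)) => // Ua'.
  by rewrite (introT forall_inP)// => z; rewrite !inE => /orP[]/eqP ->.
have -> : #|[set class_elt xi; class_elt xi']| = 2%N by rewrite cards2 (inj_eq class_elt_inj) xx.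
by rewrite (_ : 2 ^+ 2 = 4 :> R)// -natrX.
Qed.

Lemma sum_Pr_uncovered_class_ge :
  expR (- (lam / (1 - p ^+ d))) * (M%:R - (small_const m)%:R * u ^+ m.+1) <=
  \sum_xi q xi.
Proof.
have := sum_Pr_uncovered_ge m Godd p0 p1' u1 p1 [set class_elt xi | xi in {: inversion_class G}].
rewrite card_imset; last exact: class_elt_inj.
by rewrite big_imset //=; move=> xi xi' _ _; exact: class_elt_inj.
Qed.

Lemma Pr_all_covered_ge a : expR (- lam + K * eps) <= a -> a < 1 ->
  expR (- (M%:R * a / (1 - a))) <= Pr all_covered.
Proof.
move=> qa a1; have a0 : 0 <= a by apply: le_trans qa; exact: expR_ge0.
under eq_bern_mean do rewrite all_coveredE.
apply: le_trans (Pr_none_ge p0 p1' U_decr _).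
apply: le_trans (exp_le_pow _ a0 a1) _.
rewrite big_enum -prodr_const; apply: ler_prod => xi _.
by rewrite subr_ge0 (ltW a1) lerD2l lerN2 (le_trans (Pr_uncovered_le xi)).
Qed.

(** The sum of the covariances is the sum of the probabilities that two classes
    are both uncovered, minus the square of [\sum_xi q xi], plus the diagonal
    terms of that square. *)
Lemma Pr_all_covered_le L : 0 <= L -> L <= \sum_xi q xi ->
  Pr all_covered <= expR (- L) +
    (M%:R ^+ 2 * expR (- (2 * lam) + 4 * (K * eps)) - L ^+ 2 +
     M%:R * expR (- lam + K * eps) ^+ 2).
Proof.
move=> L0 LS; under eq_bern_mean do rewrite all_coveredE.
apply: le_trans (Pr_none_le p0 p1' U_decr (enum_uniq _)) _.
rewrite !big_enum /= lerD//.
  apply: (@le_trans _ _ (expR (- \sum_xi q xi))); last by rewrite ler_expR lerN2.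
  rewrite -sumrN expR_sum; apply: ler_prod => xi _.
  have /andP[q0 q1] := Pr_event_itv p0 p1' U xi.
  by rewrite subr_ge0 q1 expR_ge1Dx.
have q0 xi : 0 <= q xi by have /andP[] := Pr_event_itv p0 p1' U xi.
set a := expR (- lam + _); set b := expR _.
apply: (@le_trans _ _ (\sum_xi ((\sum_(xi' | xi' != xi) b) - q xi * (\sum_xi' q xi') + q xi ^+ 2))).
  apply: ler_sum => xi _; rewrite big_enum_cond /= sumrB -addrA lerD//.
    by apply: ler_sum => xi' xx; apply: Pr_uncovered2_le; rewrite eq_sym.
  rewrite -mulr_sumr [in X in _ <= X](bigD1 xi)//= mulrDr -expr2.
  by rewrite opprD addrAC addNr add0r.
rewrite big_split sumrB /= lerD// ?lerB//.
- rewrite expr2 -mulrA mulr_natl -sumr_const; apply: ler_sum => xi _.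
  rewrite sumr_const -[leLHS]mulr_natl ler_wpM2r ?expR_ge0// ler_nat.
  by apply: subset_leq_card; apply/fintype.subsetP.
- rewrite -mulr_suml -expr2; apply: lerXn2r => //; rewrite ?nnegrE//.
  exact: le_trans LS.
- rewrite mulr_natl -sumr_const; apply: ler_sum => xi _.
  by apply: lerXn2r; rewrite ?nnegrE ?expR_ge0// Pr_uncovered_le.
Qed.

End CoverProbability.

(** * The limit at the critical time *)

Section Asymptotics.
Context {R : realType}.
Local Open Scope classical_set_scope.

Lemma cvg_root0 (k : nat) (x : R^nat) : (forall n, 0 <= x n) ->
  x n ^+ k.+1 @[n --> \oo] --> (0 : R) -> x n @[n --> \oo] --> (0 : R).
Proof.
move=> x0 xk; apply/cvgr0Pnorm_lt => e e0.
have /cvgr0Pnorm_lt /(_ (e ^+ k.+1) (exprn_gt0 _ e0)) := xk.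
apply: filterS => n; rewrite !ger0_norm ?exprn_ge0//.
by rewrite ltr_pXn2r ?nnegrE ?x0 ?(ltW e0).
Qed.

Lemma cvg_pow_expN (k : nat) (x : R^nat) : x n @[n --> \oo] --> +oo ->
  x n ^+ k * expR (- x n) @[n --> \oo] --> (0 : R).
Proof.
move=> xoo; apply/cvgr0Pnorm_lt => e e0.
have : \forall n \near \oo, 1 + k.+1`!%:R / e <= x n by move/cvgryPge : xoo; exact.
apply: filterS => n xn.
have f0 : 0 < k.+1`!%:R :> R by rewrite ltr0n fact_gt0.
have x0 : 0 < x n by apply: lt_le_trans xn; rewrite ltr_pwDl// divr_ge0 ?ltW.
rewrite ger0_norm ?mulr_ge0 ?exprn_ge0 ?expR_ge0 ?(ltW x0)//.
rewrite expRN ltr_pdivrMr ?expR_gt0//.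
apply: (@lt_le_trans _ _ (e * (x n ^+ k.+1 / k.+1`!%:R))); last first.
  rewrite ler_wpM2l ?(ltW e0)//; apply: le_trans (expR_ge1Dxn k (ltW x0)).
  by rewrite lerDr.
have : k.+1`!%:R < e * x n.
  by rewrite -ltr_pdivrMl// mulrC; apply: lt_le_trans xn; rewrite ltrDr.
move: (k.+1`!%:R) f0 => f f0 fe.
rewrite (_ : e * _ = x n ^+ k * (e * x n / f)); last by rewrite exprS; field; rewrite gt_eqF.
by rewrite ltr_pMr ?exprn_gt0// ltr_pdivlMr// mul1r.
Qed.

Lemma cvg_expR (x : R^nat) (l : R) :
  x n @[n --> \oo] --> l -> expR (x n) @[n --> \oo] --> expR l.
Proof. by move=> xl; apply: cvg_comp xl _; exact: continuous_expR. Qed.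

(** All error terms are powers of [u = N p] over powers of [N]; they are compared by
    means of [u ^ d = N (d! lam)]. *)
Lemma scale_facts (m : nat) (N p lam : R) : let d := m.+2 in let u := N * p in
  1 <= N -> 0 <= p -> 1 <= lam -> N ^+ m.+1 * p ^+ d / d`!%:R = lam ->
  [/\ p ^+ d <= d`!%:R * lam / N, 1 <= u,
      (u ^+ (2 * d).-1 / N ^+ 2) ^+ d = (d`!%:R * lam) ^+ (2 * d).-1 / N &
      u ^+ m.+1 / N <= u ^+ (2 * d).-1 / N ^+ 2].
Proof.
move=> d u N1 p0 l1.
have : 1 <= d`!%:R :> R by rewrite ler1n fact_gt0.
move: (d`!%:R : R) => f f1 E.
have N0 : 0 < N by apply: lt_le_trans N1.
have f0 : 0 < f by apply: lt_le_trans f1.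
have E1 : N ^+ m.+1 * p ^+ d = f * lam by rewrite -E [f * _]mulrC divfK ?gt_eqF.
have ud : u ^+ d = N * (f * lam) by rewrite -E1 mulrA -exprS exprMn.
have u0 : 0 <= u by rewrite mulr_ge0// ltW.
have fl1 : 1 <= f * lam by rewrite mulr_ege1.
have u1 : 1 <= u by rewrite -(@expr_ge1 _ d)// ud mulr_ege1.
have uN : N <= u ^+ d by rewrite ud ler_peMr// ltW.
have k2 : (2 * d).-1 = (m.+1 + d)%N by rewrite mul2n -addnn.
split=> //.
- rewrite ler_pdivlMr// -E1 mulrC ler_wpM2r ?exprn_ge0// exprS ler_peMr ?exprn_ege1 ?(ltW N0)//.
- rewrite expr_div_n -exprM mulnC exprM ud exprMn -exprM.
  rewrite (_ : (2 * d)%N = (2 * d).-1.+1)//.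
  rewrite exprSr /=; move: (N ^+ _) (exprn_gt0 (2 * d).-1 N0) => X X0.
  by move: (_ ^+ _) => Y; field; rewrite !gt_eqF.
- rewrite k2 exprD ler_pdivrMr// -mulrA -mulrA ler_peMr ?exprn_ge0//.
  by rewrite (_ : _ * N = u ^+ d / N) ?ler_pdivlMr ?mul1r//; field; rewrite gt_eqF.
Qed.

Context (m : nat) (G : nat -> finZmodType) (c : R) (p : R^nat).
Hypothesis Godd : forall n, odd #|G n|.
Hypothesis Ginf : #|G n| @[n --> \oo] --> \oo.
Hypothesis p0 : forall n, 0 <= p n.
Local Notation d := m.+2.

Local Notation N n := (#|G n|%:R : R).
Local Notation M n := (#|{: inversion_class (G n)}|%:R : R).
Local Notation lam n := (ln (M n) + c).

Hypothesis plam : \forall n \near \oo, N n ^+ m.+1 * p n ^+ d / d`!%:R = lam n.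

Let ME n : 2 * M n + 1 = N n.
Proof.
exact: natr_card_inversion_class.
Qed.

Let Noo : N n @[n --> \oo] --> +oo.
Proof. exact/cvgrnyP. Qed.

Let Moo : M n @[n --> \oo] --> +oo.
Proof.
apply/cvgryPge => A; have /cvgryPge/(_ (2 * A + 1)) := Noo.
by apply: filterS => n; rewrite -ME; lra.
Qed.

Let M_gt0 : \forall n \near \oo, 0 < M n.
Proof. by have /cvgryPgt := Moo; exact. Qed.

Let expR_lam n : 0 < M n -> expR (lam n) = M n * expR c.
Proof. by move=> Mn; rewrite expRD lnK. Qed.

Let lamoo : lam n @[n --> \oo] --> +oo.
Proof.
apply/cvgryPge => A; have /cvgryPge/(_ (expR (A - c))) := Moo.
apply: filterS => n H; have Mn : 0 < M n by apply: lt_le_trans H; exact: expR_gt0.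
by rewrite -lerBlDr -ler_expR lnK.
Qed.

(** Up to a constant factor, [N] exceeds [expR (lam n)]. *)
Let lam_pow_N k : lam n ^+ k / N n @[n --> \oo] --> (0 : R).
Proof.
have lim : expR c * (lam n ^+ k * expR (- lam n)) @[n --> \oo] --> (0 : R).
  by rewrite -[X in _ --> X](mulr0 (expR c)); apply: cvgMr; exact: cvg_pow_expN.
apply: squeeze_cvgr (cvg_cst 0) lim.
have lam0 : \forall n \near \oo, 0 <= lam n by have /cvgryPge := lamoo; exact.
near=> n; have Mn : 0 < M n by near: n.
have ln : 0 <= lam n by near: n.
have Nn : 0 < N n by rewrite -ME; lra.
rewrite divr_ge0 ?exprn_ge0 ?(ltW Nn)//= mulrCA ler_wpM2l ?exprn_ge0//.
rewrite expRN expR_lam// invfM mulrCA mulfV ?gt_eqF ?expR_gt0// mulr1.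
by rewrite lef_pV2 ?posrE// -ME; lra.
Unshelve. all: by end_near. Qed.

Let u n := N n * p n.
Let eps n := u n ^+ (2 * d).-1 / N n ^+ 2.

Let regime : \forall n \near \oo, [/\ 3 <= N n, 1 <= lam n, 0 < M n &
  N n ^+ m.+1 * p n ^+ d / d`!%:R = lam n].
Proof.
near=> n; split; near: n => //.
- by have /cvgryPge := Noo; exact.
- by have /cvgryPge := lamoo; exact.
Unshelve. all: by end_near. Qed.

Let facts : \forall n \near \oo, [/\ 3 <= N n, 1 <= lam n, 0 < M n &
  N n ^+ m.+1 * p n ^+ d / d`!%:R = lam n] /\
  [/\ p n ^+ d <= d`!%:R * lam n / N n, 1 <= u n,
      eps n ^+ d = (d`!%:R * lam n) ^+ (2 * d).-1 / N n &
      u n ^+ m.+1 / N n <= eps n].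
Proof.
apply: filterS regime => n [N3 l1 Mn E]; split=> //.
by apply: scale_facts => //; lra.
Qed.

Let eps_cvg : eps n @[n --> \oo] --> (0 : R).
Proof.
apply: (@cvg_root0 m.+1) => [n|].
  by rewrite /eps divr_ge0// exprn_ge0// mulr_ge0.
have : d`!%:R ^+ (2 * d).-1 * (lam n ^+ (2 * d).-1 / N n) @[n --> \oo] --> (0 : R).
  by rewrite -[X in _ --> X](mulr0 (d`!%:R ^+ (2 * d).-1)); apply: cvgMr; exact: lam_pow_N.
apply: cvg_trans; apply: near_eq_cvg.
by apply: filterS facts => n [_ [_ _ -> _]]; rewrite exprMn mulrA.
Qed.

Let lam_pd_cvg : lam n * p n ^+ d @[n --> \oo] --> (0 : R).
Proof.
have lim : d`!%:R * (lam n ^+ 2 / N n) @[n --> \oo] --> (0 : R).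
  by rewrite -[X in _ --> X](mulr0 d`!%:R); apply: cvgMr; exact: lam_pow_N.
apply: squeeze_cvgr (cvg_cst 0) lim; apply: filterS facts => n [[_ l1 _ _] [pn _ _ _]].
rewrite mulr_ge0 ?exprn_ge0 ?p0//=; last by lra.
apply: le_trans (ler_wpM2l _ pn) _; first by lra.
by rewrite expr2 -!mulrA [leRHS]mulrCA.
Qed.

Lemma cvg_time_pow : p n ^+ d @[n --> \oo] --> (0 : R).
Proof.
apply: squeeze_cvgr (cvg_cst 0) lam_pd_cvg; apply: filterS facts => n [[_ l1 _ _] _].
by rewrite exprn_ge0//= ler_peMl ?exprn_ge0.
Qed.

Let K : R := (uncovered_const m)%:R.
Let K' : R := (small_const m)%:R.

Let A n := expR (- c + K * eps n).

Let A_cvg : A n @[n --> \oo] --> expR (- c).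
Proof.
apply: cvg_expR.
  rewrite -[X in _ --> X]addr0; apply: cvgD; first exact: cvg_cst.
  by rewrite -[X in _ --> X](mulr0 K); apply: cvgMr; exact: eps_cvg.
Qed.

Let Minv_cvg : (M n)^-1 @[n --> \oo] --> (0 : R).
Proof. by apply/gtr0_cvgV0. Qed.

Let a_cvg : A n / M n @[n --> \oo] --> (0 : R).
Proof. by rewrite -[X in _ --> X](mulr0 (expR (- c))); apply: cvgM. Qed.

Let rho n := lam n * p n ^+ d / (1 - p n ^+ d).

Let one_sub_cvg (x : R^nat) : x n @[n --> \oo] --> (0 : R) -> 1 - x n @[n --> \oo] --> (1 : R).
Proof.
by move=> x0; rewrite -[X in _ --> X]subr0; apply: cvgB => //; exact: cvg_cst.
Qed.

Let rho_cvg : rho n @[n --> \oo] --> (0 : R).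
Proof.
rewrite -[X in _ --> X](mul0r (1^-1)); apply: cvgM; first exact: lam_pd_cvg.
by apply: cvgV; rewrite ?oner_neq0//; apply: one_sub_cvg; exact: cvg_time_pow.
Qed.

Let tau n := K' * (u n ^+ m.+1 / M n).

Let tau_cvg : tau n @[n --> \oo] --> (0 : R).
Proof.
rewrite -[X in _ --> X](mulr0 K'); apply: cvgMr.
have lim : 3 * eps n @[n --> \oo] --> (0 : R).
  by rewrite -[X in _ --> X](mulr0 3); apply: cvgMr; exact: eps_cvg.
apply: squeeze_cvgr (cvg_cst 0) lim; apply: filterS facts => n [[N3 _ Mn _] [_ u1 _ ue]].
rewrite divr_ge0 ?exprn_ge0 ?(ltW Mn)//=; last by lra.
apply: (@le_trans _ _ (3 * (u n ^+ m.+1 / N n))); last by rewrite ler_wpM2l.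
rewrite mulrCA ler_wpM2l ?exprn_ge0//; first by lra.
have Nn : 0 < N n by lra.
by rewrite ler_pdivlMr// mulrC ler_pdivrMr// -ME in N3 *; lra.
Qed.

Let L n := expR (- c - rho n) * (1 - tau n).

Let L_cvg : L n @[n --> \oo] --> expR (- c).
Proof.
rewrite -[X in _ --> X]mulr1; apply: cvgM; last exact: one_sub_cvg.
apply: cvg_expR.
rewrite -[X in _ --> X]subr0; apply: cvgB; first exact: cvg_cst.
exact: rho_cvg.
Qed.

Let lower n := expR (- (A n / (1 - A n / M n))).
Let upper n := expR (- L n) + (expR (- (2 * c) + 4 * (K * eps n)) - L n ^+ 2 + A n ^+ 2 / M n).

Let lower_cvg : lower n @[n --> \oo] --> expR (- expR (- c)).
Proof.
apply: cvg_expR.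
  apply: cvgN; rewrite -[X in _ --> X]mulr1 -[X in _ * X]invr1; apply: cvgM => //.
  by apply: cvgV; rewrite ?oner_neq0//; apply: one_sub_cvg.
Qed.

Let upper_cvg : upper n @[n --> \oo] --> expR (- expR (- c)).
Proof.
rewrite -[X in _ --> X]addr0; apply: cvgD.
  apply: cvg_expR.
    exact: cvgN.
rewrite [X in _ --> X](_ : _ = expR (- (2 * c)) - expR (- c) ^+ 2 + 0); last first.
  by rewrite -expRM_natl mulrN subrr addr0.
apply: cvgD.
  apply: cvgB; last first.
    by rewrite expr2; under eq_fun do rewrite expr2; apply: cvgM.
  apply: cvg_expR.
    rewrite -[X in _ --> X]addr0; apply: cvgD; first exact: cvg_cst.
    rewrite -[X in _ --> X](mulr0 4); apply: cvgMr.
    by rewrite -[X in _ --> X](mulr0 K); apply: cvgMr; exact: eps_cvg.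
rewrite -[X in _ --> X](mulr0 (expR (- c) ^+ 2)); apply: cvgM => //.
by rewrite expr2; under eq_fun do rewrite expr2; apply: cvgM.
Qed.

(** At the time when [lam = log M + c], the two bounds of the preceding part have
    the same limit, as [M expR (- lam) = expR (- c)]. *)
Lemma cvg_Pr_all_covered :
  bern_mean (p n) (fun act : {set inversion_class (G n)} => (all_covered m act)%:R)
    @[n --> \oo] --> expR (- expR (- c)).
Proof.
apply: squeeze_cvgr lower_cvg upper_cvg.
near=> n.
have [[N3 l1 Mn E] [pd u1 _ _]] : [/\ 3 <= N n, 1 <= lam n, 0 < M n &
  N n ^+ m.+1 * p n ^+ d / d`!%:R = lam n] /\
  [/\ p n ^+ d <= d`!%:R * lam n / N n, 1 <= u n,
      eps n ^+ d = (d`!%:R * lam n) ^+ (2 * d).-1 / N n &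
      u n ^+ m.+1 / N n <= eps n] by near: n; exact: facts.
have pd1 : p n ^+ d < 1 by near: n; apply: (cvgr_lt _ cvg_time_pow); exact: ltr01.
have p1 : p n < 1 by rewrite -(@expr_lt1 _ d).
have a1 : A n / M n < 1 by near: n; apply: (cvgr_lt _ a_cvg); exact: ltr01.
have tau1 : tau n < 1 by near: n; apply: (cvgr_lt _ tau_cvg); exact: ltr01.
have lamA : expR (- lam n + K * eps n) = A n / M n.
  rewrite /A !expRD !expRN expR_lam// invfM.
  by move: (expR c)^-1 (M n)^-1 (expR _) => x y z; ring.
apply/andP; split.
  have := @Pr_all_covered_ge R (G n) m (p n) (Godd n) (p0 n) p1 u1 (A n / M n).
  rewrite E -/(N n) -/(u n) -/(eps n) -/K lamA => /(_ (lexx _) a1).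
  by rewrite /lower -/(M n) [M n * _]mulrC divfK ?gt_eqF.
have L0 : 0 <= L n by rewrite mulr_ge0 ?expR_ge0 ?subr_ge0 ?(ltW tau1).
have := @Pr_all_covered_le R (G n) m (p n) (Godd n) (p0 n) p1 u1 (L n) L0.
rewrite E -/(N n) -/(u n) -/(eps n) -/K lamA -/(M n).
have -> : M n * (A n / M n) ^+ 2 = A n ^+ 2 / M n.
  by rewrite expr2; field; rewrite gt_eqF.
have -> : M n ^+ 2 * expR (- (2 * lam n) + 4 * (K * eps n)) = expR (- (2 * c) + 4 * (K * eps n)).
  rewrite !expRD mulrA; congr (_ * _); rewrite -!mulrN !expRM_natl !expRN expR_lam//.
  by rewrite -exprMn invfM mulrA mulfV ?gt_eqF// mul1r.
apply; have := @sum_Pr_uncovered_class_ge R (G n) m (p n) (Godd n) (p0 n) p1 u1.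
rewrite E -/(N n) -/(u n) -/(M n) -/K'; apply: le_trans.
rewrite le_eqVlt; apply/orP; left; apply/eqP.
have -> : lam n / (1 - p n ^+ d) = lam n + rho n.
  by rewrite /rho; field; rewrite gt_eqF// subr_gt0.
rewrite /L opprD !expRD [expR (- lam n)]expRN expR_lam// invfM -expRN /tau.
by field; rewrite gt_eqF.
Unshelve. all: by end_near. Qed.

End Asymptotics.

(** * Diameter and covering *)

Section CayleyDiameter.
Context {R : realType} {G : finZmodType}.
Implicit Types (S : {set G}) (x y z : G).

Lemma diameter_le_walkP (V : finType) (e : rel V) (d : nat) :
  (diameter R e <= d%:R%:E)%E <->
  forall x y : V, exists p, [/\ path e x p, last x p = y & (size p <= d)%N].
Proof.
split=> [de x y|walk].
  have : (graph_dist R e x y < d.+1%:R%:E)%E.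
    apply: (@le_lt_trans _ _ (d%:R%:E)%E); last by rewrite lte_fin ltr_nat ltnSn.
    by apply: le_trans de; apply: ereal_sup_ubound; exists (x, y).
  move=> /ereal_inf_lt[_ [p [pe pl] <-]]; rewrite lte_fin ltr_nat ltnS => pd.
  by exists p.
apply: ge_ereal_sup => _ [[x y] _ <-] /=.
have [p [pe pl pd]] := walk x y.
apply: ereal_inf_le; exists (size p)%:R%:E; first by exists p.
by rewrite lee_fin ler_nat.
Qed.

Lemma last_scanl_sum x (s : seq G) : last x (scanl +%R x s) = x + \sum_(a <- s) a.
Proof.
elim: s x => /= [|a s IHs] x; first by rewrite big_nil addr0.
by rewrite IHs big_cons addrA.
Qed.

Lemma cayley_walkP S x y (d : nat) :
  (exists p, [/\ path (cayley_graph S) x p, last x p = y & (size p <= d)%N]) <->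
  (exists s : seq G, [/\ all (mem S) s, \sum_(a <- s) a = y - x & (size s <= d)%N]).
Proof.
split=> [[p [pe <- pd]]|[s [sS sy sd]]].
  exists (pairmap (fun a b => b - a) x p); rewrite size_pairmap; split=> // {pd}.
    by elim: p x pe => //= a p IHp x /andP[xa /IHp ->]; rewrite andbT.
  elim: p x pe => /= [|a p IHp] x; first by rewrite big_nil subrr.
  by move=> /andP[_ /IHp]; rewrite big_cons => ->; rewrite addrC addrA subrK.
exists (scanl +%R x s); rewrite size_scanl last_scanl_sum sy addrC subrK; split=> //.
elim: s x sS {sy sd} => //= a s IHs x /andP[aS /IHs ->]; rewrite andbT.
by rewrite /cayley_graph addrAC subrr add0r.
Qed.

Lemma covered_seqP (d : nat) (act : {set inversion_class G}) z :
  (exists s : seq G, [/\ all (mem (connection_set act)) s, \sum_(a <- s) a = z &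
     (size s <= d)%N]) <-> covered d act z.
Proof.
split=> [[s [sS sz sd]]|/coveredP[f fa fs]].
  apply/coveredP; exists [ffun i : 'I_d => nth 0 s i].
    move=> i; rewrite ffunE in_setU1; have [si|si] := ltnP i (size s).
      by have /= -> := allP sS _ (mem_nth 0 si); rewrite orbT.
    by rewrite nth_default ?eqxx.
  under eq_bigr do rewrite ffunE.
  rewrite -sz (big_nth 0) big_mkord (big_ord_widen d (fun i => s`_i)) //.
  rewrite [RHS]big_mkcond; apply: eq_bigr => i _; case: ltnP => // si.
  by rewrite nth_default.
exists [seq a <- codom f | a != 0]; split.
- apply/allP => a; rewrite mem_filter => /andP[a0 /codomP[i ai]].
  by have := fa i; rewrite -ai in_setU1 (negPf a0).
- rewrite big_filter big_rmcond => [|a /negPn /eqP //].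
  by rewrite /codom /image_mem big_map big_enum.
- by rewrite size_filter (leq_trans (count_size _ _))// size_codom card_ord.
Qed.

Lemma diameter_coveredP (d : nat) (act : {set inversion_class G}) :
  (diameter R (cayley_graph (connection_set act)) <= d%:R%:E)%E <->
  forall z, covered d act z.
Proof.
rewrite diameter_le_walkP; split=> [walk z|cov x y].
  by apply/covered_seqP; have /cayley_walkP := walk 0 z; rewrite subr0.
by apply/cayley_walkP/covered_seqP; exact: cov.
Qed.

Lemma covered_full (d : nat) z : (0 < d)%N -> covered d [set: inversion_class G]%SET z.
Proof.
move=> d0; apply/covered_seqP; have [->|z0] := eqVneq z 0.
  by exists [::]; rewrite big_nil.
exists [:: z]; rewrite big_seq1 /= andbT; split=> //.
have [xi zxi] := inversion_class_ex z0.
by apply/connection_setP; exists xi; rewrite ?inE.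
Qed.

(** The infimum defining [diam_time] is attained: shortly after time [r], no class
    becomes active that was not active at time [r]. *)
Lemma diam_time_leP (d : nat) (t : inversion_class G -> R) (r : R) : (0 < d)%N -> 0 <= r ->
  diam_time d t <= r <-> forall z, covered d (active t r) z.
Proof.
move=> d0 r0; rewrite /diam_time; set E := [set r : R | _]%classic.
have lbE : has_lbound E by exists 0 => s [].
have actS s s' : s <= s' -> active t s \subset active t s'.
  by move=> ss'; apply/fintype.subsetP => xi; rewrite !inE => /le_trans; exact.
have E0 : (E !=set0)%classic.
  exists (\big[Num.max/0]_xi t xi); split; first exact: bigmax_ge_id.
  apply/diameter_coveredP => z; apply: coveredS (covered_full z d0).
  by apply/fintype.subsetP => xi _; rewrite inE; exact: le_bigmax.
split=> [Er z|cov]; last by apply: ge_inf => //; split=> //; apply/diameter_coveredP.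
have : \forall s \near (r^'+)%classic, forall xi, (t xi <= s) = (t xi <= r).
  apply: filter_forall => xi; have [tr|rt] := leP (t xi) r.
    near=> s; apply: le_trans tr _; near: s; exact: nbhs_right_ge.
  near=> s; apply/negbTE; rewrite -ltNge; near: s; exact: nbhs_right_lt.
move=> near_eq.
have [s [rs sE]] : exists s, r < s /\ forall xi, (t xi <= s) = (t xi <= r).
  near ((r^'+)%classic) => s; exists s; split; first by near: s; exact: nbhs_right_gt.
  by near: s.
have [s' [s'0 /diameter_coveredP cov] s's] := inf_lt E0 (le_lt_trans Er rs).
apply: coveredS (cov z); apply: (fintype.subset_trans (actS _ _ (ltW s's))).
by apply/fintype.subsetP => xi; rewrite !inE sE.
Unshelve. all: by end_near. Qed.

Lemma diam_time_ge0 (d : nat) (t : inversion_class G -> R) : 0 <= diam_time d t.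
Proof.
rewrite /diam_time; set E := [set r : R | _]%classic.
have [->|/set0P E0] := eqVneq E set0%classic; first by rewrite inf0.
by apply: lb_le_inf => // r [].
Qed.

End CayleyDiameter.

(** * The law of the active classes *)

Section ActiveProbability.
Context {R : realType} {G : finZmodType} (dO : measure_display)
  (Omega : measurableType dO) (P : probability Omega R)
  (T : inversion_class G -> {RV P >-> R}).
Hypothesis Tindep : mutually_independent P T.
Hypothesis Tunif : forall xi, uniform01 P (T xi).
Local Open Scope classical_set_scope.

Lemma uniform01_le (X : {RV P >-> R}) (r : R) : uniform01 P X -> 0 <= r <= 1 ->
  P (X @^-1` `]-oo, r]) = r%:E.
Proof.
move=> Xu /andP[r0 r1]; have := Xu `]-oo, r] (measurable_itv _).
rewrite /distribution /pushforward => ->.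
rewrite /uniform_prob integral_uniform_pdf.
rewrite (_ : _ `&` _ = `[0, r]).
  rewrite (eq_integral (fun=> 1%:E)); last first.
    move=> x; rewrite inE/= in_itv/= /uniform_pdf => /andP[x0 xr].
    by rewrite x0 (le_trans xr r1) subr0 invr1.
  rewrite integral_cst//= mul1e lebesgue_measure_itv/= lte_fin.
  by case: ltgtP r0 => // [_ _|<- _]; rewrite ?sube0.
apply/seteqP; split => x /=; rewrite !in_itv/=.
  by move=> [-> /andP[-> _]].
by move=> /andP[-> xr]; rewrite xr (le_trans xr r1).
Qed.

Let B (r : R) (A : {set inversion_class G}) (xi : inversion_class G) : set R :=
  if xi \in A then `]-oo, r] else ~` `]-oo, r].

Let measurable_B r A xi : measurable (B r A xi).
Proof. by rewrite /B; case: ifP => _; [|apply: measurableC]; exact: measurable_itv. Qed.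

Let active_eqE r A : [set w | active (fun xi => T xi w) r = A] =
  \bigcap_(xi in [set` [set: inversion_class G]%SET]) (T xi @^-1` B r A xi).
Proof.
apply/seteqP; split => w /=.
  move=> wA xi _; rewrite /B -wA inE /=; case: ifPn => //=; rewrite in_itv//=.
  by move/negP.
move=> wB; apply/setP => xi; rewrite inE.
have := wB xi; rewrite /= inE => /(_ isT); rewrite /B.
by case: ifP => _ /=; rewrite in_itv//= => /negP/negbTE.
Qed.

Lemma measurable_active (r : R) (A : {set inversion_class G}) :
  measurable [set w | active (fun xi => T xi w) r = A].
Proof.
rewrite active_eqE; apply: fin_bigcap_measurable => // xi _.
by apply: measurable_funPTI; exact: measurable_B.
Qed.

(** The event is the intersection, over all classes, of conditions on the
    independent times. *)
Lemma active_prob (r : R) (A : {set inversion_class G}) : 0 <= r <= 1 ->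
  P [set w | active (fun xi => T xi w) r = A] =
  (r ^+ #|A| * (1 - r) ^+ #|~: A|%SET)%:E.
Proof.
move=> r01; rewrite active_eqE Tindep; last exact: measurable_B.
rewrite (eq_bigr (fun xi => (if xi \in A then r else 1 - r)%:E)); last first.
  move=> xi _; rewrite /B; case: ifP => _; first exact: uniform01_le.
  have mX : measurable (T xi @^-1` `]-oo, r]) by apply: measurable_funPTI; exact: measurable_itv.
  by rewrite preimage_setC probability_setC// uniform01_le.
rewrite prodEFin; congr (_%:E); rewrite (bigID (mem A)) /=; congr (_ * _).
  rewrite (eq_bigl (fun xi => xi \in A)) => [|xi]; last by rewrite /= inE.
  by rewrite (eq_bigr (fun=> r)) => [|xi ->//]; rewrite prodr_const.
rewrite (eq_bigl (fun xi => xi \in (~: A)%SET)) => [|xi]; last by rewrite /= !inE.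
by rewrite (eq_bigr (fun=> 1 - r)) => [|xi]; rewrite ?prodr_const// inE => /negPf ->.
Qed.

Lemma active_prob_pred (r : R) (Q : pred {set inversion_class G}) : 0 <= r <= 1 ->
  P [set w | Q (active (fun xi => T xi w) r)] =
  (bern_mean r (fun A => (Q A)%:R))%:E.
Proof.
move=> r01.
have -> : [set w | Q (active (fun xi => T xi w) r)] =
    \bigcup_(A in [set` Q]) [set w | active (fun xi => T xi w) r = A].
  apply/seteqP; split => w /=; first by move=> Qw; exists (active (fun xi => T xi w) r).
  by move=> [A /= QA ->].
rewrite measure_fin_bigcup//; last 2 first.
- by move=> A B' _ _ [w [/= -> ->]].
- by move=> A _; exact: measurable_active.
rewrite -(@bigfs _ _ _ _ (index_enum {set inversion_class G})) ?index_enum_uniq//=; last first.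
  by move=> A _; rewrite mem_index_enum.
rewrite (eq_bigr (fun A : {set inversion_class G} =>
  (r ^+ #|A| * (1 - r) ^+ #|~: A|%SET)%:E)) => [|A _]; last exact: active_prob.
rewrite sumEFin big_mkcond /=; congr (_%:E); apply: eq_bigr => A _.
by case: (Q A); rewrite ?mulr1 ?mulr0.
Qed.

End ActiveProbability.

(** * The limit law *)

(** The map [r |-> N ^ (d - 1) r ^ d / d!] is increasing on nonnegative times and
    takes the value [log M + c] at [p]. *)
Lemma normalized_diam_time_leP (R : realType) (G : finZmodType) (m : nat)
  (dO : measure_display) (Omega : measurableType dO) (P : probability Omega R)
  (T : inversion_class G -> {RV P >-> R}) (w : Omega) (c p : R) :
  0 <= p ->
  #|G|%:R ^+ m.+1 * p ^+ m.+2 / (m.+2)`!%:R = ln ((#|G|%:R - 1) / 2) + c ->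
  (normalized_diam_time m.+2 T w <= c) = all_covered m (active (fun xi => T xi w) p).
Proof.
move=> p0 E; rewrite /normalized_diam_time lerBlDr addrC -E /=.
have N0 : (0 < #|G|%:R :> R) by rewrite ltr0n; apply/card_gt0P; exists 0.
rewrite [leRHS]mulrAC ler_pM2l ?divr_gt0 ?exprn_gt0 ?N0 ?ltr0n ?fact_gt0//.
rewrite ler_pXn2r ?nnegrE ?diam_time_ge0//.
apply/idP/forallP => [h z|h].
  by apply: (@diam_time_leP R G m.+2 _ p _ p0).1.
by apply: (@diam_time_leP R G m.+2 _ p _ p0).2.
Qed.

Local Open Scope classical_set_scope.

Theorem corollary1p3 (R : realType) (d : nat) (hd : (2 <= d)%N)
    (G : nat -> finZmodType)
    (Godd : forall n, odd #|G n|)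
    (Ginf : #|G n| @[n --> \oo] --> \oo)
    (dO : nat -> measure_display)
    (Omega : forall n, measurableType (dO n))
    (P : forall n, probability (Omega n) R)
    (T : forall n, inversion_class (G n) -> {RV (P n) >-> R})
    (Tindep : forall n, mutually_independent (P n) (T n))
    (Tunif : forall n xi, uniform01 (P n) (T n xi))
    (dY : measure_display) (OmegaY : measurableType dY)
    (PY : probability OmegaY R) (GGum : {RV PY >-> R})
    (GGum_cdf : forall c : R, cdf GGum c = (expR (- expR (- c)))%:E) :
  cvg_in_distribution P (fun n => normalized_diam_time d (T n)) PY GGum.
Proof.
case: d hd => [|[|m]] // _ c _; rewrite GGum_cdf.
pose N n : R := #|G n|%:R.
pose lam n : R := ln ((N n - 1) / 2) + c.
(* The time whose normalization is [c], once [lam n] is nonnegative. *)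
pose p n : R := ((m.+2)`!%:R * lam n / N n ^+ m.+1) `^ (m.+2)%:R^-1.
have p0 n : 0 <= p n by exact: powR_ge0.
have cardG_gt0 n : 0 < N n by rewrite ltr0n; apply/card_gt0P; exists 0.
have ME n : #|{: inversion_class (G n)}|%:R = (N n - 1) / 2 :> R.
  have := natr_card_inversion_class (Godd n) R; rewrite -/(N n).
  by move=> <-; rewrite addrK mulrC mulKf// pnatr_eq0.
have lam0 : \forall n \near \oo, 0 <= lam n.
  have /cvgryPge/(_ (1 + 2 * expR (- c))) : N n @[n --> \oo] --> +oo by exact/cvgrnyP.
  apply: filterS => n Nn.
  have h : expR (- c) <= (N n - 1) / 2.
    by rewrite ler_pdivlMr ?ltr0n// mulrC lerBrDl.
  rewrite /lam -lerBlDr sub0r -ler_expR lnK//.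
  by rewrite posrE; apply: lt_le_trans h; exact: expR_gt0.
have pE : \forall n \near \oo, N n ^+ m.+1 * p n ^+ m.+2 / (m.+2)`!%:R = lam n.
  apply: filterS lam0 => n l0.
  have f0 : (0 < (m.+2)`!%:R :> R) by rewrite ltr0n fact_gt0.
  have x0 : 0 <= (m.+2)`!%:R * lam n / N n ^+ m.+1.
    by rewrite divr_ge0 ?mulr_ge0 ?(ltW f0)// exprn_ge0// ltW.
  have -> : p n ^+ m.+2 = (m.+2)`!%:R * lam n / N n ^+ m.+1.
    by rewrite -powR_mulrn// -powRrM mulVf ?pnatr_eq0// powRr1.
  rewrite [N n ^+ _ * _]mulrC divfK ?gt_eqF ?exprn_gt0//.
  by rewrite mulrAC mulfV ?gt_eqF// mul1r.
have pE' : \forall n \near \oo, N n ^+ m.+1 * p n ^+ m.+2 / (m.+2)`!%:R =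
    ln #|{: inversion_class (G n)}|%:R + c.
  by apply: filterS pE => n ->; rewrite ME.
have p1 : \forall n \near \oo, p n < 1.
  have /cvgr_lt/(_ 1 ltr01) := cvg_time_pow Godd Ginf p0 pE'.
  by apply: filterS => n; rewrite expr_lt1.
have cdfE : \forall n \near \oo, (bern_mean (p n)
    (fun act : {set inversion_class (G n)} => (all_covered m act)%:R))%:E =
    cdf (normalized_diam_time m.+2 (T n) : {RV P n >-> R}) c.
  near=> n; have pn1 : p n < 1 by near: n.
  have pEn : N n ^+ m.+1 * p n ^+ m.+2 / (m.+2)`!%:R = lam n by near: n.
  rewrite -(active_prob_pred (Tindep n) (Tunif n)) ?p0 ?ltW//.
  rewrite /cdf /distribution /pushforward; congr (P n _).
  by apply/seteqP; split=> w /=; rewrite in_itv/=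
    (@normalized_diam_time_leP _ _ _ _ _ _ _ _ c (p n)).
apply: cvg_trans (near_eq_cvg cdfE) _.
apply: cvg_EFin; first by near=> n.
exact: cvg_Pr_all_covered p0 pE'.
Unshelve. all: by end_near. Qed.
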